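(* Let $Q$ be a nonempty semisymmetric quasigroup, let $\mathbf{P}$ be the variety of semisymmetric quasigroups, let $\widetilde{G}=U(Q;\mathbf{P})$ be the universal multiplication group of $Q$ in $\mathbf{P}$, and let $e\in Q$, so that $\widetilde{G}_e$ is the universal stabilizer of $Q$ in $\mathbf{P}$. Let $J\mathbb{Z}\widetilde{G}_e$ be the two-sided ideal of the integral group ring $\mathbb{Z}\widetilde{G}_e$ generated by $$\left\{\widetilde{R}(ye)\bigl(\widetilde{R}(x)\widetilde{R}(y)+\widetilde{R}(yx)^{-1}\bigr)\widetilde{R}(xe)^{-1}\ \middle|\ x,y\in Q\right\}.$$ Then $Q$-modules, as abelian group objects in the slice category $\mathbf{P}/Q$, are equivalent to modules over the quotient ring $\mathbb{Z}\widetilde{G}_e/J\mathbb{Z}\widetilde{G}_e$; that is, the category of abelian group objects in $\mathbf{P}/Q$ is equivalent to the category of modules over $\mathbb{Z}\widetilde{G}_e/J\mathbb{Z}\widetilde{G}_e$.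
   Context: A quasigroup $(Q,\cdot,/,\backslash)$ is a set with three binary operations satisfying $y\backslash(y\cdot x)=x$, $x=(x\cdot y)/y$, $y\cdot(y\backslash x)=x$, $x=(x/y)\cdot y$. Products are usually written by concatenation. A quasigroup is semisymmetric if $(yx)y=x$ for all $x,y$; equivalently $y(xy)=x$, equivalently $y\backslash x=xy$, equivalently $y/x=xy$. $\mathbf{P}$ is the variety (category) of semisymmetric quasigroups, with quasigroup homomorphisms. The slice category $\mathbf{P}/Q$ has as objects the $\mathbf{P}$-morphisms $\pi:E\to Q$, and as morphisms the $\mathbf{P}$-morphisms commuting with the maps to $Q$. A $Q$-module in $\mathbf{P}$ is an abelian group object in $\mathbf{P}/Q$. $Q[X]$ is the coproduct in $\mathbf{P}$ of $Q$ with the free semisymmetric quasigroup on the one-element set $\{X\}$; the canonical map $Q\to Q[X]$ is injective and $Q$ is regarded as a subquasigroup of $Q[X]$. For $q\in Q$, $\widetilde{R}(q):u\mapsto uq$ and $\widetilde{L}(q):u\mapsto qu$ are the right and left multiplications by $q$ on the set $Q[X]$; they are permutations of $Q[X]$. The universal multiplication group $\widetilde{G}=U(Q;\mathbf{P})$ is the subgroup of the symmetric group on the set $Q[X]$ generated by all $\widetilde{R}(q),\widetilde{L}(q)$, $q\in Q$. The group $\widetilde{G}$ maps the subset $Q\subseteq Q[X]$ to itself and acts transitively on it; the universal stabilizer $\widetilde{G}_e$ is the stabilizer of the point $e\in Q$ under this action. The displayed generators are computed in $\mathbb{Z}\widetilde{G}$ and lie in $\mathbb{Z}\widetilde{G}_e$.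 Conventions: permutations act on the right and are composed left to right; correspondingly, modules over group rings and their quotients are right modules. *)

(* Defs.v *)
From HB Require Import structures.
From mathcomp Require Import all_boot all_algebra finmap.
From mathcomp Require Import boolp classical_sets.
From mathcomp.multinomials Require Import monalg.

Set Implicit Arguments.
Unset Strict Implicit.
Unset Printing Implicit Defensive.

Import GRing.Theory.

Local Open Scope classical_set_scope.
Local Open Scope quotient_scope.
Local Open Scope ring_scope.

#[local] Obligation Tactic := idtac.

Reserved Notation "g \oc f" (at level 50, left associativity).

Record category := Category {
  obj :> Type;
  hom : obj -> obj -> Type;
  idm : forall A, hom A A;
  comp : forall A B C, hom B C -> hom A B -> hom A C;
  comp1m : forall A B (f : hom A B), comp (idm B) f = f;
  compm1 : forall A B (f : hom A B), comp f (idm A) = f;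
  compA : forall A B C D (h : hom C D) (g : hom B C) (f : hom A B),
    comp h (comp g f) = comp (comp h g) f
}.
Arguments hom {c} A B.
Arguments idm {c} A.
Arguments comp {c A B C} g f.
Notation "g \oc f" := (comp g f).

Record functor (C D : category) := Functor {
  fobj :> C -> D;
  fhom : forall A B : C, hom A B -> hom (fobj A) (fobj B);
  fhom1 : forall A : C, fhom (idm A) = idm (fobj A);
  fhomM : forall (A B E : C) (g : hom B E) (f : hom A B),
    fhom (g \oc f) = fhom g \oc fhom f
}.
Arguments fhom {C D} f {A B} _ : rename.

Definition fid (C : category) : functor C C :=
  @Functor C C (fun A => A) (fun _ _ f => f)
    (fun=> erefl) (fun _ _ _ _ _ => erefl).

Program Definition fcomp (C D E : category) (G : functor D E)
    (F : functor C D) : functor C E :=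
  @Functor C E (fun A => G (F A)) (fun _ _ f => fhom G (fhom F f)) _ _.
Next Obligation. by move=> * /=; rewrite !fhom1. Qed.
Next Obligation. by move=> * /=; rewrite !fhomM. Qed.

Record nat_iso (C D : category) (F G : functor C D) := NatIso {
  ni_fwd : forall A, hom (F A) (G A);
  ni_bwd : forall A, hom (G A) (F A);
  ni_fwdK : forall A, ni_bwd A \oc ni_fwd A = idm (F A);
  ni_bwdK : forall A, ni_fwd A \oc ni_bwd A = idm (G A);
  ni_nat : forall A B (f : hom A B),
    ni_fwd B \oc fhom F f = fhom G f \oc ni_fwd A
}.

Definition equivalent (C D : category) : Prop :=
  exists (F : functor C D) (G : functor D C),
    inhabited (nat_iso (fcomp G F) (fid C)) /\
    inhabited (nat_iso (fcomp F G) (fid D)).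

Definition is_coproduct (C : category) (A B S : C)
    (i : hom A S) (j : hom B S) : Prop :=
  forall (T : C) (f : hom A T) (g : hom B T),
    exists! h : hom S T, h \oc i = f /\ h \oc j = g.

Record cartesian (C : category) := Cartesian {
  cone : C;
  cbang : forall A, hom A cone;
  cbang_uniq : forall A (f : hom A cone), f = cbang A;
  cprod : C -> C -> C;
  cfst : forall A B, hom (cprod A B) A;
  csnd : forall A B, hom (cprod A B) B;
  cpair : forall X A B, hom X A -> hom X B -> hom X (cprod A B);
  cfst_pair : forall X A B (f : hom X A) (g : hom X B),
    cfst A B \oc cpair f g = f;
  csnd_pair : forall X A B (f : hom X A) (g : hom X B),
    csnd A B \oc cpair f g = g;
  cpair_uniq : forall X A B (h : hom X (cprod A B)),
    h = cpair (cfst A B \oc h) (csnd A B \oc h)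
}.
Arguments cbang {C} c A.
Arguments cfst {C c A B}.
Arguments csnd {C c A B}.
Arguments cpair {C c X A B} f g.

Record abgrp_obj (C : category) (P : cartesian C) := AbgrpObj {
  ag_obj :> C;
  ag_add : hom (cprod P ag_obj ag_obj) ag_obj;
  ag_zero : hom (cone P) ag_obj;
  ag_opp : hom ag_obj ag_obj;
  ag_addA :
    let x : hom (cprod P ag_obj (cprod P ag_obj ag_obj)) ag_obj := cfst in
    let y := cfst \oc csnd in
    let z := csnd \oc csnd in
    ag_add \oc cpair x (ag_add \oc cpair y z) =
    ag_add \oc cpair (ag_add \oc cpair x y) z;
  ag_addC : ag_add \oc cpair csnd cfst = ag_add;
  ag_add0 : ag_add \oc cpair (ag_zero \oc cbang P ag_obj) (idm ag_obj)
            = idm ag_obj;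
  ag_addN : ag_add \oc cpair ag_opp (idm ag_obj) = ag_zero \oc cbang P ag_obj
}.

Record abgrp_hom (C : category) (P : cartesian C) (A B : abgrp_obj P) :=
  AbgrpHom {
  ah_hom :> hom (A : C) (B : C);
  ah_add : ah_hom \oc ag_add A =
           ag_add B \oc cpair (ah_hom \oc cfst) (ah_hom \oc csnd);
  ah_zero : ah_hom \oc ag_zero A = ag_zero B;
  ah_opp : ah_hom \oc ag_opp A = ag_opp B \oc ah_hom
}.

Lemma abgrp_hom_ext (C : category) (P : cartesian C) (A B : abgrp_obj P)
  (f g : abgrp_hom A B) : ah_hom f = ah_hom g -> f = g.
Proof.
case: f g => f f1 f2 f3 [g g1 g2 g3] /= fg; case: g / fg in g1 g2 g3 *.
by rewrite (Prop_irrelevance f1 g1) (Prop_irrelevance f2 g2)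
           (Prop_irrelevance f3 g3).
Qed.

Lemma comp_cpair (C : category) (P : cartesian C) (X Y A B : C)
  (f : hom X A) (g : hom X B) (h : hom Y X) :
  @cpair C P _ _ _ f g \oc h = cpair (f \oc h) (g \oc h).
Proof. by rewrite [LHS]cpair_uniq !compA cfst_pair csnd_pair. Qed.

Program Definition abgrp_id (C : category) (P : cartesian C)
  (A : abgrp_obj P) : abgrp_hom A A := @AbgrpHom C P A A (idm _) _ _ _.
Next Obligation.
move=> C P A; rewrite !comp1m.
suff <- : idm (cprod P A A) = cpair cfst csnd by rewrite compm1.
by rewrite [LHS]cpair_uniq !compm1.
Qed.
Next Obligation. by move=> C P A; rewrite comp1m. Qed.
Next Obligation. by move=> C P A; rewrite comp1m compm1. Qed.

Program Definition abgrp_comp (C : category) (P : cartesian C)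
  (A B D : abgrp_obj P) (g : abgrp_hom B D) (f : abgrp_hom A B) :
  abgrp_hom A D := @AbgrpHom C P A D (ah_hom g \oc ah_hom f) _ _ _.
Next Obligation.
move=> C P A B D g f; rewrite -compA ah_add compA ah_add -compA comp_cpair.
by rewrite -!compA cfst_pair csnd_pair !compA.
Qed.
Next Obligation. by move=> C P A B D g f; rewrite -compA !ah_zero. Qed.
Next Obligation.
by move=> C P A B D g f; rewrite -compA ah_opp compA ah_opp compA.
Qed.

Program Definition abgrp_cat (C : category) (P : cartesian C) : category :=
  @Category (abgrp_obj P) (@abgrp_hom C P) (@abgrp_id C P)
    (@abgrp_comp C P) _ _ _.
Next Obligation. by move=> C P A B f; apply/abgrp_hom_ext/comp1m. Qed.
Next Obligation. by move=> C P A B f; apply/abgrp_hom_ext/compm1. Qed.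
Next Obligation. by move=> C P A B D E h g f; apply/abgrp_hom_ext/compA. Qed.

Record slice_obj (C : category) (Q : C) := SliceObj {
  sl_obj :> C;
  sl_map : hom sl_obj Q
}.

Record slice_hom (C : category) (Q : C) (A B : slice_obj Q) := SliceHom {
  sl_hom :> hom (A : C) (B : C);
  sl_homP : sl_map B \oc sl_hom = sl_map A
}.

Lemma slice_hom_ext (C : category) (Q : C) (A B : slice_obj Q)
  (f g : slice_hom A B) : sl_hom f = sl_hom g -> f = g.
Proof.
case: f g => f f1 [g g1] /= fg; case: g / fg in g1 *.
by rewrite (Prop_irrelevance f1 g1).
Qed.

Program Definition slice (C : category) (Q : C) : category :=
  @Category (slice_obj Q) (@slice_hom C Q)
    (fun A => @SliceHom C Q A A (idm _) (compm1 _))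
    (fun A B D g f => @SliceHom C Q A D (sl_hom g \oc sl_hom f) _) _ _ _.
Next Obligation. by move=> C Q A B D g f; rewrite compA !sl_homP. Qed.
Next Obligation. by move=> C Q A B f; apply/slice_hom_ext/comp1m. Qed.
Next Obligation. by move=> C Q A B f; apply/slice_hom_ext/compm1. Qed.
Next Obligation. by move=> C Q A B D E h g f; apply/slice_hom_ext/compA. Qed.

Reserved Notation "x ** y" (at level 40, left associativity).

(* [qrdiv x y] is [x / y] and [qldiv y x] is [y \ x]. *)
HB.mixin Record isQuasigroup T := {
  qmul : T -> T -> T;
  qrdiv : T -> T -> T;
  qldiv : T -> T -> T;
  qldivK : forall x y, qldiv y (qmul y x) = x;
  qrdivK : forall x y, x = qrdiv (qmul x y) y;
  qmulKl : forall x y, qmul y (qldiv y x) = x;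
  qmulKr : forall x y, x = qmul (qrdiv x y) y
}.
#[short(type="quasigroupType")]
HB.structure Definition Quasigroup := {T of isQuasigroup T}.
Notation "x ** y" := (qmul x y).

HB.mixin Record isSemisymmetric T of Quasigroup T := {
  semisym : forall x y : T, (y ** x) ** y = x
}.
#[short(type="ssqType")]
HB.structure Definition SemisymQuasigroup :=
  {T of isSemisymmetric T & Quasigroup T}.

Lemma semisymr (Q : ssqType) (x y : Q) : y ** (x ** y) = x.
Proof. by rewrite -{1}(semisym y x); exact: semisym. Qed.

Record ssq_hom (A B : ssqType) := SsqHom {
  sq_fun :> A -> B;
  sq_mul : forall x y, sq_fun (x ** y) = sq_fun x ** sq_fun y;
  sq_rdiv : forall x y, sq_fun (qrdiv x y) = qrdiv (sq_fun x) (sq_fun y);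
  sq_ldiv : forall x y, sq_fun (qldiv x y) = qldiv (sq_fun x) (sq_fun y)
}.

Lemma ssq_hom_ext (A B : ssqType) (f g : ssq_hom A B) : f =1 g -> f = g.
Proof.
case: f g => f f1 f2 f3 [g g1 g2 g3] /= /funext fg.
case: g / fg in g1 g2 g3 *.
by rewrite (Prop_irrelevance f1 g1) (Prop_irrelevance f2 g2)
           (Prop_irrelevance f3 g3).
Qed.

Section HomOfMul.
Variables (A B : ssqType) (f : A -> B).
Hypothesis fM : forall x y, f (x ** y) = f x ** f y.

Lemma hom_of_mul_rdiv x y : f (qrdiv x y) = qrdiv (f x) (f y).
Proof. by rewrite [in RHS](qmulKr x y) fM -qrdivK. Qed.

Lemma hom_of_mul_ldiv x y : f (qldiv x y) = qldiv (f x) (f y).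
Proof. by rewrite -[in RHS](qmulKl y x) fM qldivK. Qed.

Definition hom_of_mul : ssq_hom A B :=
  SsqHom fM hom_of_mul_rdiv hom_of_mul_ldiv.
End HomOfMul.

Definition ssq_id (A : ssqType) : ssq_hom A A :=
  @SsqHom A A id (fun _ _ => erefl) (fun _ _ => erefl) (fun _ _ => erefl).

Program Definition ssq_comp (A B D : ssqType) (g : ssq_hom B D)
  (f : ssq_hom A B) : ssq_hom A D := @SsqHom A D (g \o f) _ _ _.
Next Obligation. by move=> * /=; rewrite !sq_mul. Qed.
Next Obligation. by move=> * /=; rewrite !sq_rdiv. Qed.
Next Obligation. by move=> * /=; rewrite !sq_ldiv. Qed.

Program Definition ssq_cat : category :=
  @Category ssqType ssq_hom ssq_id ssq_comp _ _ _.
Next Obligation. by move=> *; apply/ssq_hom_ext. Qed.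
Next Obligation. by move=> *; apply/ssq_hom_ext. Qed.
Next Obligation. by move=> *; apply/ssq_hom_ext. Qed.

Section Pullback.
Variables (A B Q : ssqType) (f : ssq_hom A Q) (g : ssq_hom B Q).

Definition pullback : Type := {p : A * B | f p.1 = g p.2}.

Lemma pullback_ext (p q : pullback) : sval p = sval q -> p = q.
Proof. by case: p q => p hp [q hq] /= pq; apply: eq_exist. Qed.

Lemma pb_mulP (p q : pullback) :
  f ((sval p).1 ** (sval q).1) = g ((sval p).2 ** (sval q).2).
Proof. by rewrite !sq_mul (svalP p) (svalP q). Qed.
Lemma pb_rdivP (p q : pullback) :
  f (qrdiv (sval p).1 (sval q).1) = g (qrdiv (sval p).2 (sval q).2).
Proof. by rewrite !sq_rdiv (svalP p) (svalP q). Qed.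
Lemma pb_ldivP (p q : pullback) :
  f (qldiv (sval p).1 (sval q).1) = g (qldiv (sval p).2 (sval q).2).
Proof. by rewrite !sq_ldiv (svalP p) (svalP q). Qed.

Definition pb_mul (p q : pullback) : pullback :=
  exist _ ((sval p).1 ** (sval q).1, (sval p).2 ** (sval q).2) (pb_mulP p q).
Definition pb_rdiv (p q : pullback) : pullback :=
  exist _ (qrdiv (sval p).1 (sval q).1, qrdiv (sval p).2 (sval q).2)
    (pb_rdivP p q).
Definition pb_ldiv (p q : pullback) : pullback :=
  exist _ (qldiv (sval p).1 (sval q).1, qldiv (sval p).2 (sval q).2)
    (pb_ldivP p q).

Lemma pb_ldivK p q : pb_ldiv q (pb_mul q p) = p.
Proof. by apply: pullback_ext; case: p => -[a b] h /=; rewrite !qldivK. Qed.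
Lemma pb_rdivK p q : p = pb_rdiv (pb_mul p q) q.
Proof. by apply: pullback_ext; case: p => -[a b] h /=; rewrite -!qrdivK. Qed.
Lemma pb_mulKl p q : pb_mul q (pb_ldiv q p) = p.
Proof. by apply: pullback_ext; case: p => -[a b] h /=; rewrite !qmulKl. Qed.
Lemma pb_mulKr p q : p = pb_mul (pb_rdiv p q) q.
Proof. by apply: pullback_ext; case: p => -[a b] h /=; rewrite -!qmulKr. Qed.
Lemma pb_semisym p q : pb_mul (pb_mul q p) q = p.
Proof. by apply: pullback_ext; case: p => -[a b] h /=; rewrite !semisym. Qed.

HB.instance Definition _ :=
  isQuasigroup.Build pullback pb_ldivK pb_rdivK pb_mulKl pb_mulKr.
HB.instance Definition _ := isSemisymmetric.Build pullback pb_semisym.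

Definition pb_fst : ssq_hom pullback A :=
  @SsqHom pullback A (fun p => (sval p).1)
    (fun _ _ => erefl) (fun _ _ => erefl) (fun _ _ => erefl).
Definition pb_snd : ssq_hom pullback B :=
  @SsqHom pullback B (fun p => (sval p).2)
    (fun _ _ => erefl) (fun _ _ => erefl) (fun _ _ => erefl).

Program Definition pb_pair (X : ssqType) (a : ssq_hom X A) (b : ssq_hom X B)
  (ab : forall x, f (a x) = g (b x)) : ssq_hom X pullback :=
  @SsqHom X pullback (fun x => exist _ (a x, b x) (ab x)) _ _ _.
Next Obligation. by move=> *; apply: pullback_ext; rewrite /= !sq_mul. Qed.
Next Obligation. by move=> *; apply: pullback_ext; rewrite /= !sq_rdiv. Qed.
Next Obligation. by move=> *; apply: pullback_ext; rewrite /= !sq_ldiv. Qed.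

End Pullback.

Section SliceProducts.
Variable Q : ssqType.
Local Notation SQ := (@slice ssq_cat Q).

Definition sl_pi (A : SQ) : ssq_hom (sl_obj A) Q := sl_map A.

Definition sl_one : SQ := @SliceObj ssq_cat Q Q (ssq_id Q).

Program Definition sl_bang (A : SQ) : @hom SQ A sl_one :=
  @SliceHom ssq_cat Q A sl_one (sl_pi A) _.
Next Obligation. by move=> A; apply: ssq_hom_ext. Qed.

Definition sl_prod (A B : SQ) : SQ :=
  @SliceObj ssq_cat Q (pullback (sl_pi A) (sl_pi B) : ssqType)
    (ssq_comp (sl_pi A) (pb_fst (sl_pi A) (sl_pi B))).

Definition sl_fst (A B : SQ) : @hom SQ (sl_prod A B) A :=
  @SliceHom ssq_cat Q (sl_prod A B) A (pb_fst (sl_pi A) (sl_pi B)) erefl.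

Program Definition sl_snd (A B : SQ) : @hom SQ (sl_prod A B) B :=
  @SliceHom ssq_cat Q (sl_prod A B) B (pb_snd (sl_pi A) (sl_pi B)) _.
Next Obligation. by move=> A B; apply: ssq_hom_ext => -[p hp] /=. Qed.

Lemma sl_pairP (X A B : SQ) (a : @hom SQ X A) (b : @hom SQ X B)
  (x : sl_obj X : ssqType) :
  sl_pi A ((sl_hom a : ssq_hom _ _) x) = sl_pi B ((sl_hom b : ssq_hom _ _) x).
Proof.
have := congr1 (fun h : ssq_hom _ _ => h x) (sl_homP a).
by have := congr1 (fun h : ssq_hom _ _ => h x) (sl_homP b) => /= -> ->.
Qed.

Program Definition sl_pair (X A B : SQ) (a : @hom SQ X A) (b : @hom SQ X B) :
  @hom SQ X (sl_prod A B) :=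
  @SliceHom ssq_cat Q X (sl_prod A B) (pb_pair (sl_pairP a b)) _.
Next Obligation.
by move=> X A B a b; rewrite -(sl_homP a); apply: ssq_hom_ext.
Qed.

(* Products in P/Q are pullbacks over Q; the terminal object is the identity. *)
Program Definition slice_cartesian : cartesian SQ :=
  @Cartesian SQ sl_one sl_bang _ sl_prod sl_fst sl_snd sl_pair _ _ _.
Next Obligation.
move=> A f; apply/slice_hom_ext/ssq_hom_ext => x /=.
exact: (congr1 (fun h : ssq_hom _ _ => h x) (sl_homP f)).
Qed.
Next Obligation. by move=> *; apply/slice_hom_ext/ssq_hom_ext. Qed.
Next Obligation. by move=> *; apply/slice_hom_ext/ssq_hom_ext. Qed.
Next Obligation.
move=> X A B h; apply/slice_hom_ext/ssq_hom_ext => x.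
by apply: pullback_ext => /=; case: (sval _).
Qed.

End SliceProducts.

Inductive qterm (A : Type) : Type :=
| QVar of A
| QMul of qterm A & qterm A
| QRdiv of qterm A & qterm A
| QLdiv of qterm A & qterm A.
Arguments QVar {A} a.

HB.instance Definition _ (A : Type) := gen_eqMixin (qterm A).
HB.instance Definition _ (A : Type) := gen_choiceMixin (qterm A).

Section Presented.
Variables (A : Type) (rel : qterm A -> qterm A -> Prop).

Inductive qcong : qterm A -> qterm A -> Prop :=
| QC_rel s t : rel s t -> qcong s t
| QC_refl t : qcong t t
| QC_sym s t : qcong s t -> qcong t s
| QC_trans s t u : qcong s t -> qcong t u -> qcong s u
| QC_mul s s' t t' : qcong s s' -> qcong t t' -> qcong (QMul s t) (QMul s' t')
| QC_rdiv s s' t t' :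
    qcong s s' -> qcong t t' -> qcong (QRdiv s t) (QRdiv s' t')
| QC_ldiv s s' t t' :
    qcong s s' -> qcong t t' -> qcong (QLdiv s t) (QLdiv s' t')
| QC_ldivK x y : qcong (QLdiv y (QMul y x)) x
| QC_rdivK x y : qcong x (QRdiv (QMul x y) y)
| QC_mulKl x y : qcong (QMul y (QLdiv y x)) x
| QC_mulKr x y : qcong x (QMul (QRdiv x y) y)
| QC_semisym x y : qcong (QMul (QMul y x) y) x.

Definition qcongb (s t : qterm A) : bool := `[< qcong s t >].

Lemma qcongb_equiv : equiv_class_of qcongb.
Proof.
split=> [s|s t|t s u]; first exact/asboolP/QC_refl.
  by apply/asboolP/asboolP; apply: QC_sym.
by move=> /asboolP st /asboolP tu; apply/asboolP/QC_trans; [exact: st|].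
Qed.
Canonical qcongb_equivrel := EquivRelPack qcongb_equiv.

Definition presented : Type := {eq_quot qcongb}.
Definition qclass (t : qterm A) : presented := \pi_{eq_quot qcongb} t.
Definition qrepr (x : presented) : qterm A := repr (x : {eq_quot qcongb}).

HB.instance Definition _ := Choice.copy presented {eq_quot qcongb}.

Lemma qclassK x : qclass (qrepr x) = x. Proof. exact: reprK. Qed.

Lemma qclassP s t : qclass s = qclass t <-> qcong s t.
Proof.
rewrite /qclass; split=> [st|st]; last exact/eqmodP/asboolP.
by apply/asboolP; move/eqmodP: st.
Qed.

Lemma qreprK t : qcong (qrepr (qclass t)) t.
Proof. by apply/qclassP; rewrite qclassK. Qed.

Definition pr_mul (x y : presented) := qclass (QMul (qrepr x) (qrepr y)).
Definition pr_rdiv (x y : presented) := qclass (QRdiv (qrepr x) (qrepr y)).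
Definition pr_ldiv (x y : presented) := qclass (QLdiv (qrepr x) (qrepr y)).

Lemma pr_mulE s t : pr_mul (qclass s) (qclass t) = qclass (QMul s t).
Proof. exact/qclassP/QC_mul/qreprK/qreprK. Qed.
Lemma pr_rdivE s t : pr_rdiv (qclass s) (qclass t) = qclass (QRdiv s t).
Proof. exact/qclassP/QC_rdiv/qreprK/qreprK. Qed.
Lemma pr_ldivE s t : pr_ldiv (qclass s) (qclass t) = qclass (QLdiv s t).
Proof. exact/qclassP/QC_ldiv/qreprK/qreprK. Qed.

Lemma pr_ldivK x y : pr_ldiv y (pr_mul y x) = x.
Proof.
rewrite -(qclassK x) -(qclassK y) pr_mulE pr_ldivE; exact/qclassP/QC_ldivK.
Qed.
Lemma pr_rdivK x y : x = pr_rdiv (pr_mul x y) y.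
Proof.
rewrite -(qclassK x) -(qclassK y) pr_mulE pr_rdivE; exact/qclassP/QC_rdivK.
Qed.
Lemma pr_mulKl x y : pr_mul y (pr_ldiv y x) = x.
Proof.
rewrite -(qclassK x) -(qclassK y) pr_ldivE pr_mulE; exact/qclassP/QC_mulKl.
Qed.
Lemma pr_mulKr x y : x = pr_mul (pr_rdiv x y) y.
Proof.
rewrite -(qclassK x) -(qclassK y) pr_rdivE pr_mulE; exact/qclassP/QC_mulKr.
Qed.
Lemma pr_semisym x y : pr_mul (pr_mul y x) y = x.
Proof.
rewrite -(qclassK x) -(qclassK y) !pr_mulE; exact/qclassP/QC_semisym.
Qed.

HB.instance Definition _ :=
  isQuasigroup.Build presented pr_ldivK pr_rdivK pr_mulKl pr_mulKr.
HB.instance Definition _ := isSemisymmetric.Build presented pr_semisym.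

Section Universal.
Variables (B : ssqType) (v : A -> B).

Fixpoint qeval (t : qterm A) : B :=
  match t with
  | QVar a => v a
  | QMul s t => qeval s ** qeval t
  | QRdiv s t => qrdiv (qeval s) (qeval t)
  | QLdiv s t => qldiv (qeval s) (qeval t)
  end.

Hypothesis relP : forall s t, rel s t -> qeval s = qeval t.

Lemma qeval_cong s t : qcong s t -> qeval s = qeval t.
Proof.
elim=> {s t} /= [s t /relP //|t //|s t _ -> //|s t u _ -> _ ->|s s' t t' _ -> _ ->
  |s s' t t' _ -> _ ->|s s' t t' _ -> _ ->|x y|x y|x y|x y|x y] //.
- by rewrite qldivK.
- by rewrite -qrdivK.
- by rewrite qmulKl.
- by rewrite -qmulKr.
- by rewrite semisym.
Qed.

Lemma presented_univ :
  exists! h : ssq_hom presented B, forall a, h (qclass (QVar a)) = v a.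
Proof.
have hE t : qeval (qrepr (qclass t)) = qeval t by apply/qeval_cong/qreprK.
have hM (x y : presented) : qeval (qrepr (x ** y)) =
    qeval (qrepr x) ** qeval (qrepr y) by rewrite hE.
exists (hom_of_mul hM); split=> [a|g gE]; first exact: hE.
apply: ssq_hom_ext => x; rewrite -(qclassK x) /= hE.
elim: (qrepr x) => [a|s IHs t IHt|s IHs t IHt|s IHs t IHt] /=.
- by rewrite gE.
- by rewrite -pr_mulE sq_mul IHs IHt.
- by rewrite -pr_rdivE sq_rdiv IHs IHt.
- by rewrite -pr_ldivE sq_ldiv IHs IHt.
Qed.
End Universal.

End Presented.

Definition freeq (A : Type) : ssqType := presented (fun _ _ : qterm A => False).
Definition freeq_gen (A : Type) (a : A) : freeq A := qclass _ (QVar a).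

Lemma freeq_univ (A : Type) (B : ssqType) (v : A -> B) :
  exists! h : ssq_hom (freeq A) B, forall a, h (freeq_gen a) = v a.
Proof. exact: presented_univ. Qed.

(* Multiplication tables of the two factors; the division tables follow since a
   multiplicative map between quasigroups preserves the divisions. *)
Inductive coprod_rel (A B : ssqType) : qterm (A + B) -> qterm (A + B) -> Prop :=
| CR_inl x y :
    coprod_rel (QMul (QVar (inl x)) (QVar (inl y))) (QVar (inl (x ** y)))
| CR_inr x y :
    coprod_rel (QMul (QVar (inr x)) (QVar (inr y))) (QVar (inr (x ** y))).

Definition coprodq (A B : ssqType) : ssqType := presented (@coprod_rel A B).

Section Coproduct.
Variables A B : ssqType.

Definition cp_inlr (x : A + B) : coprodq A B := qclass _ (QVar x).

Lemma cp_inlM x y :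
  cp_inlr (inl (x ** y)) = cp_inlr (inl x) ** cp_inlr (inl y).
Proof. by rewrite [RHS]pr_mulE; apply/qclassP/QC_sym/QC_rel/CR_inl. Qed.
Lemma cp_inrM x y :
  cp_inlr (inr (x ** y)) = cp_inlr (inr x) ** cp_inlr (inr y).
Proof. by rewrite [RHS]pr_mulE; apply/qclassP/QC_sym/QC_rel/CR_inr. Qed.

Definition cp_inl : ssq_hom A (coprodq A B) := hom_of_mul cp_inlM.
Definition cp_inr : ssq_hom B (coprodq A B) := hom_of_mul cp_inrM.

Lemma coprodq_univ :
  @is_coproduct ssq_cat A B (coprodq A B) cp_inl cp_inr.
Proof.
move=> T f g.
pose v (x : A + B) : T :=
  match x with inl a => (f : ssq_hom A T) a | inr b => (g : ssq_hom B T) b end.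
have [|h [hE h_uniq]] := @presented_univ _ (@coprod_rel A B) T v.
  by move=> s t [] x y /=; rewrite sq_mul.
exists h; split.
  split; apply: ssq_hom_ext => x; [exact: (hE (inl x))|exact: (hE (inr x))].
move=> k [kf kg]; apply: h_uniq => -[a|b].
- by rewrite /= -kf.
- by rewrite /= -kg.
Qed.
End Coproduct.

Definition subgroup (G : groupType) (H : set G) : Prop :=
  [/\ H 1%g, forall x y, H x -> H y -> H (x * y)%g &
      forall x, H x -> H x^-1%g].

Lemma smallest_subgroup (G : groupType) (S : set G) :
  subgroup (smallest (@subgroup G) S).
Proof.
split=> [H [[H1 _ _] _] //|x y xS yS H HS|x xS H HS].
- by case: (HS) => -[_ HM _] _; apply: HM; [apply: xS|apply: yS].
- by case: (HS) => -[_ _ HV] _; apply: HV; apply: xS.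
Qed.

Section Sym.
Variable T : Type.

Record sym := Sym {
  sym_fun :> T -> T;
  sym_inv : T -> T;
  symK : cancel sym_fun sym_inv;
  symVK : cancel sym_inv sym_fun
}.

Lemma sym_ext (f g : sym) : f =1 g -> f = g.
Proof.
move=> /funext fg.
have fgV : sym_inv f = sym_inv g.
  by apply/funext => x; rewrite -{1}(symVK g x) -fg symK.
case: f g fg fgV => f f' f1 f2 [g g' g1 g2] /= fg fg'.
case: g / fg in g1 g2 *; case: g' / fg' in g1 g2 *.
by rewrite (Prop_irrelevance f1 g1) (Prop_irrelevance f2 g2).
Qed.

HB.instance Definition _ := gen_eqMixin sym.
HB.instance Definition _ := gen_choiceMixin sym.

Definition sym1 : sym := @Sym id id (fun=> erefl) (fun=> erefl).
Definition symV (f : sym) : sym := Sym (symVK f) (symK f).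

(* Permutations act on the right: in the product [f * g], [f] acts first. *)
Definition symM (f g : sym) : sym :=
  @Sym (fun x => g (f x)) (fun x => sym_inv f (sym_inv g x))
    (can_comp (symK g) (symK f)) (can_comp (symVK f) (symVK g)).

Lemma symMA : associative symM. Proof. by move=> f g h; apply: sym_ext. Qed.
Lemma sym1M : left_id sym1 symM. Proof. by move=> f; apply: sym_ext. Qed.
Lemma symM1 : right_id sym1 symM. Proof. by move=> f; apply: sym_ext. Qed.
Lemma symVM : left_inverse sym1 symV symM.
Proof. by move=> f; apply: sym_ext => x /=; rewrite symVK. Qed.
Lemma symMV : right_inverse sym1 symV symM.
Proof. by move=> f; apply: sym_ext => x /=; rewrite symK. Qed.

HB.instance Definition _ := isGroup.Build sym symMA sym1M symM1 symVM symMV.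
End Sym.

(* [polyq Q] is Q[X], with X the generator of [freeq unit]. *)
Definition polyq (Q : ssqType) : ssqType := coprodq Q (freeq unit).
Definition polyq_inj (Q : ssqType) : ssq_hom Q (polyq Q) :=
  cp_inl Q (freeq unit).

Lemma polyq_injP (Q : ssqType) : injective (polyq_inj Q).
Proof.
move=> x y xy; have [c _] := freeq_univ (fun _ : unit => x).
have [r [[rQ _] _]] := @coprodq_univ Q (freeq unit) Q (ssq_id Q) c.
have rK z : (r : ssq_hom _ _) (polyq_inj Q z) = z.
  exact: (congr1 (fun h : ssq_hom _ _ => h z) rQ).
by rewrite -(rK x) -(rK y) xy.
Qed.

Section UniversalMultiplicationGroup.
Variable Q : ssqType.
Local Notation i := (polyq_inj Q).

Lemma Rmul_K (q : Q) : cancel (fun u => u ** i q) (fun u => qrdiv u (i q)).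
Proof. by move=> u; rewrite -qrdivK. Qed.
Lemma Rmul_VK (q : Q) : cancel (fun u => qrdiv u (i q)) (fun u => u ** i q).
Proof. by move=> u; rewrite -qmulKr. Qed.
Lemma Lmul_K (q : Q) : cancel (fun u => i q ** u) (fun u => qldiv (i q) u).
Proof. by move=> u; rewrite qldivK. Qed.
Lemma Lmul_VK (q : Q) : cancel (fun u => qldiv (i q) u) (fun u => i q ** u).
Proof. by move=> u; rewrite qmulKl. Qed.

Definition Rmul (q : Q) : sym (polyq Q) := Sym (Rmul_K q) (Rmul_VK q).
Definition Lmul (q : Q) : sym (polyq Q) := Sym (Lmul_K q) (Lmul_VK q).

Definition umult_set : set (sym (polyq Q)) :=
  smallest (@subgroup (sym (polyq Q)))
    [set g | exists q : Q, g = Rmul q \/ g = Lmul q].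

Record umult := UMult {
  umult_val :> sym (polyq Q);
  umultP : umult_val \in umult_set
}.
HB.instance Definition _ := [isSub for umult_val].
HB.instance Definition _ := [Choice of umult by <:].

Lemma umult_closed : group_closed (mem umult_set).
Proof.
have [H1 HM HV] := smallest_subgroup
  [set g | exists q : Q, g = Rmul q \/ g = Lmul q].
split; first exact/mem_set.
move=> x y /set_mem xH /set_mem yH; apply/mem_set.
exact: (HM _ _ xH (HV _ yH)).
Qed.
HB.instance Definition _ := SubChoice_isSubGroup.Build
  (sym (polyq Q)) (mem umult_set) umult umult_closed.

Lemma RmulP (q : Q) : Rmul q \in umult_set.
Proof. by apply/mem_set; apply: sub_gen_smallest; exists q; left. Qed.

Definition Rt (q : Q) : umult := UMult (RmulP q).

Variable e : Q.

(* [i] is injective, so fixing [i e] in Q[X] is fixing the point [e] of Q. *)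
Record ustab := UStab {
  ustab_val :> umult;
  ustabP : ustab_val (i e) == i e
}.
HB.instance Definition _ := [isSub for ustab_val].
HB.instance Definition _ := [Choice of ustab by <:].

Lemma ustab_closed :
  group_closed [pred g : umult | g (i e) == i e].
Proof.
split=> [|g h /eqP ge /eqP he]; first exact/eqP.
by apply/eqP; rewrite [LHS](congr1 (sym_inv h) ge) -[in LHS]he symK.
Qed.
HB.instance Definition _ := SubChoice_isSubGroup.Build
  umult [pred g : umult | g (i e) == i e] ustab ustab_closed.

End UniversalMultiplicationGroup.

Definition group_ring (G : groupType) : Type := {malg int[G]}.

Section GroupRing.
Variable G : groupType.
Local Notation ZG := (group_ring G).

HB.instance Definition _ := GRing.Zmodule.copy ZG {malg int[G]}.

Definition gr (g : G) : ZG := << 1 *g g >>.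

Definition gr_mul (a b : ZG) : ZG :=
  \sum_(g <- msupp a) \sum_(h <- msupp b) << a@_g * b@_h *g (g * h)%g >>.

Implicit Types (a b c : ZG) (d : {fset G}).

Lemma gr_mulw d1 d2 a b :
  fsubset (msupp a) d1 -> fsubset (msupp b) d2 ->
  gr_mul a b = \sum_(g <- d1) \sum_(h <- d2) << a@_g * b@_h *g (g * h)%g >>.
Proof.
move=> le_d1 le_d2; rewrite /gr_mul (big_fset_incl _ le_d1) /=.
  apply/eq_bigr=> k1 _; apply/big_fset_incl => // k _ /mcoeff_outdom ->.
  by rewrite mulr0 monalgU0.
move=> k _ /mcoeff_outdom ak.
by rewrite big1 => // k' _; rewrite ak mul0r monalgU0.
Qed.

Lemma gr_mulDl : left_distributive gr_mul +%R.
Proof.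
move=> a b c; pose d := fsetU (msupp a) (msupp b).
have da : fsubset (msupp a) d by apply: fsubsetUl.
have db : fsubset (msupp b) d by apply: fsubsetUr.
have dab : fsubset (msupp (a + b)) d by apply: msuppD_le.
have dc := fsubset_refl (msupp c).
rewrite (gr_mulw da dc) (gr_mulw db dc) (gr_mulw dab dc) -big_split /=.
apply/eq_bigr=> g _; rewrite -big_split /=; apply/eq_bigr=> h _.
by rewrite mcoeffD mulrDl monalgUD.
Qed.

Lemma gr_mulDr : right_distributive gr_mul +%R.
Proof.
move=> c a b; pose d := fsetU (msupp a) (msupp b).
have da : fsubset (msupp a) d by apply: fsubsetUl.
have db : fsubset (msupp b) d by apply: fsubsetUr.
have dab : fsubset (msupp (a + b)) d by apply: msuppD_le.
have dc := fsubset_refl (msupp c).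
rewrite (gr_mulw dc da) (gr_mulw dc db) (gr_mulw dc dab) -big_split /=.
apply/eq_bigr=> g _; rewrite -big_split /=; apply/eq_bigr=> h _.
by rewrite mcoeffD mulrDr monalgUD.
Qed.

Lemma gr_mul0 a : gr_mul a 0 = 0.
Proof.
by rewrite /gr_mul big1 // => g _; rewrite msupp0 big_seq_fset0.
Qed.
Lemma gr_0mul a : gr_mul 0 a = 0.
Proof. by rewrite /gr_mul msupp0 big_seq_fset0. Qed.

Lemma gr_mulUU (m n : int) (g h : G) :
  gr_mul << m *g g >> << n *g h >> = << m * n *g (g * h)%g >>.
Proof.
by rewrite (gr_mulw msuppU_le msuppU_le) !big_seq_fset1 !mcoeffUU.
Qed.

Lemma gr_ind (P : ZG -> Prop) :
  P 0 -> (forall a b, P a -> P b -> P (a + b)) ->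
  (forall (n : int) g, P << n *g g >>) -> forall a, P a.
Proof. by move=> P0 PD PU a; rewrite (monalgE a); elim/big_ind: _. Qed.

Lemma gr_mulA : associative gr_mul.
Proof.
move=> a b c; move: a b c; apply: gr_ind => [b c|a a' IH IH' b c|n g].
- by rewrite !gr_0mul.
- by rewrite !gr_mulDl IH IH'.
apply: gr_ind => [c|b b' IH IH' c|m h].
- by rewrite !(gr_mul0, gr_0mul).
- by rewrite !(gr_mulDl, gr_mulDr) IH IH'.
apply: gr_ind => [|c c' IH IH'|k l].
- by rewrite !gr_mul0.
- by rewrite !gr_mulDr IH IH'.
by rewrite !gr_mulUU mulrA mulgA.
Qed.

Lemma gr_1mul : left_id (gr 1%g) gr_mul.
Proof.
apply: gr_ind => [|a b IHa IHb|n g]; first by rewrite gr_mul0.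
- by rewrite gr_mulDr IHa IHb.
- by rewrite gr_mulUU mul1r mul1g.
Qed.

Lemma gr_mul1 : right_id (gr 1%g) gr_mul.
Proof.
apply: gr_ind => [|a b IHa IHb|n g]; first by rewrite gr_0mul.
- by rewrite gr_mulDl IHa IHb.
- by rewrite gr_mulUU mulr1 mulg1.
Qed.

Lemma gr_1neq0 : gr 1%g != 0.
Proof. by rewrite monalgU_eq0 oner_eq0. Qed.

HB.instance Definition _ := GRing.Zmodule_isNzRing.Build ZG
  gr_mulA gr_1mul gr_mul1 gr_mulDl gr_mulDr gr_1neq0.

Lemma grM (g h : G) : gr (g * h)%g = gr g * gr h.
Proof. by rewrite [RHS]gr_mulUU mulr1. Qed.

End GroupRing.

Definition gr_map (G H : groupType) (f : G -> H) (a : group_ring G) :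
  group_ring H := \sum_(g <- msupp a) << a@_g *g f g >>.

Lemma gr_mapw (G H : groupType) (f : G -> H) (d : {fset G})
  (a : group_ring G) : fsubset (msupp a) d ->
  gr_map f a = \sum_(g <- d) << a@_g *g f g >>.
Proof.
move=> ad; rewrite /gr_map; apply: big_fset_incl => // g _ /mcoeff_outdom ->.
exact: monalgU0.
Qed.

Lemma gr_mapD (G H : groupType) (f : G -> H) :
  {morph gr_map f : a b / a + b}.
Proof.
move=> a b; pose d := fsetU (msupp a) (msupp b).
have da : fsubset (msupp a) d by apply: fsubsetUl.
have db : fsubset (msupp b) d by apply: fsubsetUr.
have dab : fsubset (msupp (a + b)) d by apply: msuppD_le.
rewrite (gr_mapw _ da) (gr_mapw _ db) (gr_mapw _ dab) -big_split /=.
by apply/eq_bigr => g _; rewrite mcoeffD monalgUD.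
Qed.

Lemma gr_map_gr (G H : groupType) (f : G -> H) (g : G) :
  gr_map f (gr g) = gr (f g).
Proof. by rewrite (gr_mapw _ msuppU_le) big_seq_fset1 mcoeffUU. Qed.

Lemma gr_map_inj (G H : groupType) (f : G -> H) :
  injective f -> injective (gr_map f).
Proof.
move=> f_inj a b; have fE c g : mcoeff (f g) (gr_map f c) = mcoeff g c.
  rewrite [in RHS](monalgE c) !raddf_sum /=; apply: eq_bigr => h _.
  by rewrite !mcoeffU (inj_eq f_inj).
by move=> ab; apply/malgP => g; rewrite -!fE ab.
Qed.

Definition two_sided_ideal (R : pzRingType) (I : set R) : Prop :=
  [/\ I 0, forall x y, I x -> I y -> I (x - y),
      forall r x, I x -> I (r * x) & forall r x, I x -> I (x * r)].

Section IdealQuotient.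
Variables (R : pzRingType) (S : set R).

Definition ideal_gen : set R := smallest (@two_sided_ideal R) S.

Lemma ideal_genP : two_sided_ideal ideal_gen.
Proof.
split=> [I [[I0 _ _ _] _] //|x y xS yS I IS|r x xS I IS|r x xS I IS].
- by case: (IS) => -[_ IB _ _] _; apply: IB; [apply: xS|apply: yS].
- by case: (IS) => -[_ _ IM _] _; apply: IM; apply: xS.
- by case: (IS) => -[_ _ _ IM] _; apply: IM; apply: xS.
Qed.

Definition ideal_pred : {pred R} := mem ideal_gen.

Lemma ideal_predP x : reflect (ideal_gen x) (x \in ideal_pred).
Proof. by apply: (iffP idP) => [/set_mem|/mem_set]. Qed.

Lemma ideal_pred_closed : zmod_closed ideal_pred.
Proof.
have [I0 IB _ _] := ideal_genP; split; first exact/ideal_predP.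
move=> x y /ideal_predP xI /ideal_predP yI; apply/ideal_predP.
exact: (IB _ _ xI yI).
Qed.
HB.instance Definition _ := GRing.isZmodClosed.Build R ideal_pred
  ideal_pred_closed.

Definition ideal_quot : Type := Quotient.quot ideal_pred.
HB.instance Definition _ := GRing.Zmodule.copy ideal_quot (Quotient.quot ideal_pred).

Definition iq_class (x : R) : ideal_quot := \pi_(Quotient.quot ideal_pred) x.
Definition iq_repr (x : ideal_quot) : R :=
  repr (x : Quotient.quot ideal_pred).

Lemma iq_reprK x : iq_class (iq_repr x) = x. Proof. exact: reprK. Qed.

Lemma iq_classP x y : iq_class x = iq_class y <-> ideal_gen (x - y).
Proof.
split=> [/eqP xy|/ideal_predP xy]; last by apply/eqP; rewrite -Quotient.idealrBE.
by apply/ideal_predP; rewrite Quotient.idealrBE.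
Qed.

Lemma iq_classD : {morph iq_class : x y / x + y}.
Proof. exact: Quotient.pi_add. Qed.

Definition iq_one : ideal_quot := iq_class 1.
Definition iq_mul (x y : ideal_quot) : ideal_quot :=
  iq_class (iq_repr x * iq_repr y).

Lemma iq_mulE x y : iq_mul (iq_class x) (iq_class y) = iq_class (x * y).
Proof.
have [_ IB IMl IMr] := ideal_genP; apply/iq_classP.
set x' := iq_repr _; set y' := iq_repr _.
have xx : ideal_gen (x' - x) by apply/iq_classP; rewrite iq_reprK.
have yy : ideal_gen (y - y') by apply/iq_classP; rewrite iq_reprK.
have -> : x' * y' - x * y = (x' - x) * y' - x * (y - y').
  by rewrite mulrBl mulrBr opprB addrA subrK.
by apply: IB; [apply: IMr|apply: IMl].
Qed.

Lemma iq_mulA : associative iq_mul.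
Proof.
move=> x y z; rewrite -(iq_reprK x) -(iq_reprK y) -(iq_reprK z).
by rewrite !iq_mulE mulrA.
Qed.
Lemma iq_1mul : left_id iq_one iq_mul.
Proof. by move=> x; rewrite -(iq_reprK x) iq_mulE mul1r. Qed.
Lemma iq_mul1 : right_id iq_one iq_mul.
Proof. by move=> x; rewrite -(iq_reprK x) iq_mulE mulr1. Qed.
Lemma iq_mulDl : left_distributive iq_mul +%R.
Proof.
move=> x y z; rewrite -(iq_reprK x) -(iq_reprK y) -(iq_reprK z).
by rewrite -iq_classD !iq_mulE mulrDl iq_classD.
Qed.
Lemma iq_mulDr : right_distributive iq_mul +%R.
Proof.
move=> x y z; rewrite -(iq_reprK x) -(iq_reprK y) -(iq_reprK z).
by rewrite -iq_classD !iq_mulE mulrDr iq_classD.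
Qed.

HB.instance Definition _ := GRing.Zmodule_isPzRing.Build ideal_quot
  iq_mulA iq_1mul iq_mul1 iq_mulDl iq_mulDr.

End IdealQuotient.

Section RightModules.
Variable R : pzRingType.

Lemma linear_ext (M N : lmodType R^c) (f g : {linear M -> N}) :
  f =1 g -> f = g.
Proof.
case: f g => f [[fN] [fS]] [g [[gN] [gS]]] /= /funext fg.
case: g / fg in gN gS *.
by rewrite (Prop_irrelevance fN gN) (Prop_irrelevance fS gS).
Qed.

(* A right R-module is a left module over the converse ring [R^c]:
   [m . r] is [(r : R^c) *: m]. *)
Program Definition rmod_cat : category :=
  @Category (lmodType R^c) (fun M N => {linear M -> N})
    (fun M => idfun : {linear M -> M})
    (fun M N P g f => (g \o f) : {linear M -> P}) _ _ _.
Next Obligation. by move=> *; apply: linear_ext. Qed.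
Next Obligation. by move=> *; apply: linear_ext. Qed.
Next Obligation. by move=> *; apply: linear_ext. Qed.
End RightModules.

Section Relators.
Variables (Q : ssqType) (e : Q).
Local Notation R := (@Rt Q).

Definition relator (x y : Q) : group_ring (umult Q) :=
  gr (R (y ** e)) * (gr (R x) * gr (R y) + gr (R (y ** x))^-1%g)
  * gr (R (x ** e))^-1%g.

(* The elements of the group ring of the stabilizer whose images in the group
   ring of the whole group are the relators; [gr_map] is injective here. *)
Definition relators : set (group_ring (ustab e)) :=
  [set a | exists x y : Q, gr_map (@ustab_val Q e) a = relator x y].

Lemma relator_ustab x y :
  exists a : group_ring (ustab e), gr_map (@ustab_val Q e) a = relator x y.
Proof.
pose i := polyq_inj Q.
pose g1 := (Rt (y ** e) * Rt x * Rt y * (Rt (x ** e))^-1)%g.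
pose g2 := (Rt (y ** e) * (Rt (y ** x))^-1 * (Rt (x ** e))^-1)%g.
have VK (a b : Q) : sym_inv (Rmul (a ** b)) (i a) = i b.
  by rewrite -[a in i a](semisymr a b) /i sq_mul; exact: symK.
have g1P : g1 (i e) == i e.
  apply/eqP; transitivity (sym_inv (Rmul (x ** e))
    (((i e ** i (y ** e)) ** i x) ** i y)) => //.
  by rewrite -!sq_mul semisymr semisym VK.
have g2P : g2 (i e) == i e.
  apply/eqP; transitivity (sym_inv (Rmul (x ** e))
    (sym_inv (Rmul (y ** x)) (i e ** i (y ** e)))) => //.
  by rewrite -!sq_mul semisymr !VK.
exists (gr (UStab g1P) + gr (UStab g2P)).
by rewrite gr_mapD !gr_map_gr /relator mulrDr mulrDl !mulrA -!grM.
Qed.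
End Relators.
Arguments relators {Q} e _.

(* Main.v *)
Require Import Defs.
From mathcomp Require Import all_boot all_algebra.
From HB Require Import structures.
From mathcomp Require Import finmap boolp classical_sets.
From mathcomp.multinomials Require Import monalg.

(* Let E be an abelian group object over Q, with zero section z.  For a in E,
   let h_a : Q[X] -> E extend z and send X to a; then g . a := h_a(X g) is an
   action of the universal multiplication group G on E, natural in E, with R(q)
   acting as right multiplication by z(q).  Since addition is itself a
   homomorphism, G acts additively between the fibres, and additivity gives
   a * b = a . R(y) + b . R(x)^-1 for a over x and b over y.  Semisymmetry of E
   is then the vanishing of R(x) R(y) + R(yx)^-1 on the fibre over y; conjugated
   by R(ye) and R(xe), this says that the relators annihilate the fibre over e.
   Conversely a module M yields Q * M, with the fibre over x identified with M
   along R(xe) : e -> e(xe) = x. *)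

Set Implicit Arguments.
Unset Strict Implicit.
Unset Printing Implicit Defensive.
Import GRing.Theory.
Local Open Scope ring_scope.
#[local] Obligation Tactic := idtac.

(** * The action on objects over Q *)

Section UniversalAction.
Variable Q : ssqType.

Definition polyq_var : polyq Q := cp_inr Q (freeq unit) (freeq_gen tt).

(** Semisymmetry $(qu)q = u$ makes right multiplication undo left multiplication, so the right
    multiplications alone generate the group. *)
Lemma Lmul_inv (q : Q) : Lmul q = (Rmul q)^-1%g.
Proof.
apply: sym_ext => u /=; apply: (can_inj (Rmul_K q)).
by rewrite Rmul_VK semisym.
Qed.

Lemma umult_ind (P : umult Q -> Prop) :
  (forall q, P (Rt q)) -> P 1%g ->
  (forall g h, P g -> P h -> P (g * h)%g) -> (forall g, P g -> P g^-1%g) ->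
  forall g, P g.
Proof.
move=> PR P1 PM PV [f fG].
(* The permutations having a membership proof [fG] with [P (UMult fG)] form a subgroup containing
   the generators, hence contain the generated one. *)
have [fG' Pf] : exists fG : f \in @umult_set Q, P (UMult fG).
  apply: ((set_mem fG) (fun f => exists fG, P (UMult fG))); split.
    split; first by exists (umultP 1%g).
    - move=> x y [xG Px] [yG Py]; exists (umultP (UMult xG * UMult yG)%g).
      exact: (PM _ _ Px Py).
    - by move=> x [xG Px]; exists (umultP (UMult xG)^-1%g); apply: (PV _ Px).
  move=> _ [q [->|->]]; first by exists (RmulP q); exact: PR.
  by rewrite Lmul_inv; exists (umultP (Rt q)^-1%g); apply: (PV _ (PR q)).
by rewrite (Prop_irrelevance fG fG').
Qed.
End UniversalAction.

Lemma qmul_can (E : ssqType) (y : E) : injective (fun x => x ** y).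
Proof. by move=> x x' /= xx'; rewrite (qrdivK x y) xx' -qrdivK. Qed.

Section Action.
Variables (Q E : ssqType) (s : ssq_hom Q E).

Definition extends (h : ssq_hom (polyq Q) E) : Prop :=
  forall q, h (polyq_inj Q q) = s q.

(** An equivalence, rather than one implication, lets the induction pass to inverses; for [Rt q] its
    converse half is cancellation in [E]. It makes the action independent of the extension used. *)
Lemma extends_perm h k (g : umult Q) : extends h -> extends k ->
  forall u v, h u = k v <-> h (g u) = k (g v).
Proof.
move=> hs ks; elim/umult_ind: g => [q|//|g g' gP gP'|g gP] u v.
- rewrite /= !sq_mul hs ks; split=> [->//|]; exact: qmul_can.
- by rewrite gP gP'.
- by rewrite (gP (g^-1%g u)) /= !symVK.
Qed.

Lemma extension_exists (a : E) : exists h, extends h /\ h (polyq_var Q) = a.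
Proof.
have [c [ca _]] := freeq_univ (fun _ : unit => a).
have [h [[hs hc] _]] := @coprodq_univ Q (freeq unit) E s c.
exists h; split=> [q|]; first exact: (congr1 (fun k : ssq_hom _ _ => k q) hs).
rewrite -(ca tt).
exact: (congr1 (fun k : ssq_hom _ _ => k (freeq_gen tt)) hc).
Qed.

Definition extension (a : E) : ssq_hom (polyq Q) E :=
  sval (cid (extension_exists a)).

Lemma extensionP a : extends (extension a).
Proof. by rewrite /extension; case: cid => h []. Qed.

Lemma extension_var a : extension a (polyq_var Q) = a.
Proof. by rewrite /extension; case: cid => h []. Qed.

Definition uact (g : umult Q) (a : E) : E := extension a (g (polyq_var Q)).

(** Both [h] at [u] and the chosen extension at $X$ have the value [h u], so [extends_perm] applies:
    any extension computes the action. *)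
Lemma uact_extends h (g : umult Q) u : extends h -> h (g u) = uact g (h u).
Proof.
move=> hs; apply: (extends_perm g hs (extensionP (h u)) _ _).1.
by rewrite extension_var.
Qed.

Lemma uact1 a : uact 1%g a = a. Proof. exact: extension_var. Qed.

Lemma uactM g h a : uact (g * h)%g a = uact h (uact g a).
Proof. exact: (uact_extends h _ (extensionP a)). Qed.

Lemma uact_Rt q a : uact (Rt q) a = a ** s q.
Proof. by rewrite /uact /= sq_mul extension_var extensionP. Qed.

Lemma uactK g : cancel (uact g) (uact g^-1%g).
Proof. by move=> a; rewrite -uactM mulgV uact1. Qed.

Lemma uactVK g : cancel (uact g^-1%g) (uact g).
Proof. by move=> a; rewrite -uactM mulVg uact1. Qed.

Lemma uact_RtV q a : uact (Rt q)^-1%g a = s q ** a.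
Proof. by apply: (can_inj (uactK (Rt q))); rewrite uactVK uact_Rt semisym. Qed.

End Action.

(** Composing an extension of [s] with [f] gives an extension of [s']. *)
Lemma uact_nat (Q E E' : ssqType) (s : ssq_hom Q E) (s' : ssq_hom Q E')
    (f : ssq_hom E E') (g : umult Q) a :
  (forall q, f (s q) = s' q) -> f (uact s g a) = uact s' g (f a).
Proof.
move=> fs; rewrite -[in RHS](extension_var s a).
rewrite -[RHS](uact_extends (h := ssq_comp f (extension s a))) //.
by move=> q /=; rewrite extensionP.
Qed.

(** * The action on $Q$ itself *)

Section Base.
Variable Q : ssqType.

Definition pt (g : umult Q) (x : Q) : Q := uact (ssq_id Q) g x.

(** Naturality along the inclusion of $Q$, which the identity of $Q[X]$ extends. Thus [pt] is the
    restriction to $Q$ of the permutations of $Q[X]$. *)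
Lemma polyq_inj_pt (g : umult Q) x : polyq_inj Q (pt g x) = g (polyq_inj Q x).
Proof.
rewrite (uact_nat (s' := polyq_inj Q)) //.
by rewrite -(uact_extends (h := ssq_id (polyq Q))).
Qed.

Lemma ptM g h x : pt (g * h)%g x = pt h (pt g x). Proof. exact: uactM. Qed.
Lemma pt1 x : pt 1%g x = x. Proof. exact: uact1. Qed.
Lemma pt_Rt q x : pt (Rt q) x = x ** q. Proof. exact: uact_Rt. Qed.
Lemma pt_RtV q x : pt (Rt q)^-1%g x = q ** x. Proof. exact: uact_RtV. Qed.

Lemma pt_fix (e : Q) (g : umult Q) :
  pt g e = e <-> g (polyq_inj Q e) = polyq_inj Q e.
Proof.
by rewrite -polyq_inj_pt; split=> [->//|]; exact: polyq_injP.
Qed.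

Lemma pt_stab (e : Q) (g : ustab e) : pt g e = e.
Proof. exact/pt_fix/eqP/ustabP. Qed.
End Base.

Definition sl_eval (Q : ssqType) (X Y : @slice_obj ssq_cat Q)
    (f : slice_hom X Y) (x : sl_obj X : ssqType) : (sl_obj Y : ssqType) :=
  (sl_hom f : ssq_hom _ _) x.

Lemma sl_eval_eq (Q : ssqType) (X Y : @slice_obj ssq_cat Q)
  (f g : slice_hom X Y) : f = g -> forall x, sl_eval f x = sl_eval g x.
Proof. by move=> ->. Qed.

(** * Fibrewise addition of an abelian group object *)

Section Fibres.
Variables (Q : ssqType) (A : abgrp_obj (slice_cartesian Q)).

Definition tot : ssqType := sl_obj (ag_obj A).
Definition proj : ssq_hom tot Q := sl_map (ag_obj A).
Definition zeros : ssq_hom Q tot := sl_hom (ag_zero A).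
Definition neg : ssq_hom tot tot := sl_hom (ag_opp A).
Definition addp : ssq_hom (pullback proj proj) tot := sl_hom (ag_add A).

(* Junk value [a] when [a] and [b] lie in different fibres. *)
Definition fadd (a b : tot) : tot :=
  if pselect (proj a = proj b) is left ab then addp (exist _ (a, b) ab) else a.

Lemma faddE a b (ab : proj a = proj b) : fadd a b = addp (exist _ (a, b) ab).
Proof.
rewrite /fadd; case: pselect => // ab'.
by rewrite (Prop_irrelevance ab ab').
Qed.

Lemma proj_zeros x : proj (zeros x) = x.
Proof. exact: (congr1 (fun h : ssq_hom _ _ => h x) (sl_homP (ag_zero A))). Qed.

Lemma proj_neg a : proj (neg a) = proj a.
Proof. exact: (congr1 (fun h : ssq_hom _ _ => h a) (sl_homP (ag_opp A))). Qed.

Lemma proj_addp p : proj (addp p) = proj (sval p).1.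
Proof. exact: (congr1 (fun h : ssq_hom _ _ => h p) (sl_homP (ag_add A))). Qed.

Lemma proj_fadd a b : proj (fadd a b) = proj a.
Proof. by rewrite /fadd; case: pselect => // ab; rewrite proj_addp. Qed.

Lemma proj_uact g a : proj (uact zeros g a) = pt g (proj a).
Proof. by apply: uact_nat => q; rewrite proj_zeros. Qed.

Lemma uact_zeros g x : uact zeros g (zeros x) = zeros (pt g x).
Proof. exact/esym/uact_nat. Qed.

Lemma faddA a b c : proj a = proj b -> proj b = proj c ->
  fadd a (fadd b c) = fadd (fadd a b) c.
Proof.
move=> ab bc.
have abc : proj a = proj (addp (exist _ (b, c) bc)) by rewrite proj_addp.
have abc' : proj (addp (exist _ (a, b) ab)) = proj c.
  by rewrite proj_addp /= ab.
have abc2 : proj a = proj (pb_fst proj proj (exist _ (b, c) bc)) by [].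
have := sl_eval_eq (ag_addA A) (exist _ (a, (exist _ (b, c) bc)) abc2).
rewrite (faddE bc) (faddE ab) (faddE abc) (faddE abc').
rewrite /addp /=; set u := exist _ _ _; set v := exist _ _ _ => uv.
etransitivity; last (etransitivity; first exact: uv); congr (addp _).
  by apply: pullback_ext => /=; congr (_, addp _); apply: pullback_ext.
by apply: pullback_ext => /=; congr (addp _, _); apply: pullback_ext.
Qed.

Lemma faddC a b : proj a = proj b -> fadd a b = fadd b a.
Proof.
move=> ab; rewrite (faddE ab) (faddE (esym ab)).
apply: etrans (esym (sl_eval_eq (ag_addC A) (exist _ (a, b) ab))) _.
congr (addp _); exact: pullback_ext.
Qed.

Lemma fadd0 a : fadd (zeros (proj a)) a = a.
Proof.
have h : proj (zeros (proj a)) = proj a by rewrite proj_zeros.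
rewrite (faddE h); apply: etrans (sl_eval_eq (ag_add0 A) a).
congr (addp _); exact: pullback_ext.
Qed.

Lemma faddN a : fadd (neg a) a = zeros (proj a).
Proof.
rewrite (faddE (proj_neg a)); apply: etrans (sl_eval_eq (ag_addN A) a).
congr (addp _); exact: pullback_ext.
Qed.

(** Addition is a homomorphism on the pullback, which is this interchange law. *)
Lemma fadd_mul a b c d : proj a = proj b -> proj c = proj d ->
  fadd a b ** fadd c d = fadd (a ** c) (b ** d).
Proof.
move=> ab cd; have abcd : proj (a ** c) = proj (b ** d).
  by rewrite !sq_mul ab cd.
rewrite (faddE ab) (faddE cd) (faddE abcd) -sq_mul; congr (addp _).
exact: pullback_ext.
Qed.

(* Addition is a homomorphism E x_Q E -> E compatible with the zero sections,
   so naturality of the action makes the action additive. *)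
Lemma uact_fadd g a b : proj a = proj b ->
  uact zeros g (fadd a b) = fadd (uact zeros g a) (uact zeros g b).
Proof.
move=> ab; have ab' : proj (uact zeros g a) = proj (uact zeros g b).
  by rewrite !proj_uact ab.
pose s := @pb_pair tot tot Q proj proj Q zeros zeros (fun=> erefl).
rewrite (faddE ab) (faddE ab') -(uact_nat (s := s)) => [|q]; last first.
  rewrite -[RHS]fadd0 proj_zeros (faddE erefl); congr (addp _).
congr (addp _); apply: pullback_ext; rewrite [LHS]surjective_pairing.
congr (_, _); first exact: (uact_nat (f := pb_fst proj proj)).
exact: (uact_nat (f := pb_snd proj proj)).
Qed.

(** Write $a = a + 0_x$ and $b = 0_y + b$; the interchange law gives $ab = a0_y + 0_xb$. *)
Lemma tot_mulE a b : a ** b =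
  fadd (uact zeros (Rt (proj b)) a) (uact zeros (Rt (proj a))^-1%g b).
Proof.
have pz x : proj x = proj (zeros (proj x)) by rewrite proj_zeros.
rewrite uact_Rt uact_RtV -fadd_mul //.
by rewrite fadd0 (faddC (pz a)) fadd0.
Qed.

(** This is $(a0_x)a = 0_x$ with the outer product, of elements over $yx$ and $y$, expanded by
    [tot_mulE]. *)
Lemma fadd_relator x y a : proj a = y ->
  fadd (uact zeros (Rt x * Rt y)%g a) (uact zeros (Rt (y ** x))^-1%g a) =
  zeros x.
Proof.
move=> ay; rewrite -[RHS](semisym (zeros x) a) (tot_mulE (_ ** _)).
by rewrite sq_mul proj_zeros ay uactM (uact_Rt _ x).
Qed.

Lemma fadd_idem a : fadd a a = a -> a = zeros (proj a).
Proof.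
move=> aa; rewrite -(faddN a) -{3}aa faddA ?proj_neg // faddN.
by rewrite fadd0.
Qed.

Lemma fadd_eq0 a b : proj a = proj b -> fadd a b = zeros (proj a) -> b = neg a.
Proof.
move=> ab ab0; rewrite -(fadd0 b) -ab -(faddN a) -faddA ?proj_neg // ab0.
by rewrite faddC ?proj_neg ?proj_zeros // -(proj_neg a) fadd0.
Qed.
End Fibres.
Arguments proj {Q A}.
Arguments neg {Q A}.

(** * Right modules over quotients of group rings *)

(** Zero, negatives and sums are all obtained from differences, so every integer multiple of a group
    element is reached. *)
Lemma gr_span (G : groupType) (P : group_ring G -> Prop) :
  (forall g, P (gr g)) -> (forall a b, P a -> P b -> P (a - b)) ->
  forall a, P a.
Proof.
move=> Pg PB.
have P0 : P 0 by rewrite -(subrr (gr 1%g)); exact: (PB _ _ (Pg _) (Pg _)).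
have PN a : P a -> P (- a) by move=> Pa; rewrite -sub0r; exact: PB.
have PD a b : P a -> P b -> P (a + b).
  by move=> Pa Pb; rewrite -[b]opprK; exact: (PB _ _ Pa (PN _ Pb)).
have Pn g n : P (<< n%:Z *g g >> : group_ring G).
  elim: n => [|n IHn]; first by rewrite monalgU0.
  by rewrite -addn1 PoszD monalgUD; exact: (PD _ _ IHn (Pg g)).
apply: gr_ind => // -[n|n] g //.
by rewrite NegzE monalgUN; exact: PN.
Qed.

Lemma gr_conj (G : groupType) (a b c d f : G) :
  gr a * (gr b * gr c + gr d) * gr f =
  gr (a * (b * c) * f)%g + gr (a * d * f)%g.
Proof.
(* With [gr] abstracted, [gr g] and [gr h] are not compared by unfolding. *)
have := @grM G; move: (@gr G) => k kM.
by rewrite !kM mulrDr mulrDl.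
Qed.

Lemma gr_map_gr2 (G H : groupType) (f : G -> H) g h :
  gr_map f (gr g + gr h) = gr (f g) + gr (f h).
Proof. by rewrite gr_mapD; congr (_ + _); exact: gr_map_gr. Qed.

Section IqClass.
Variables (R : pzRingType) (S : set R).

Lemma iq_class0 : iq_class S 0 = 0.
Proof. by apply: (addIr (iq_class S 0)); rewrite -iq_classD add0r add0r. Qed.

Lemma iq_classB : {morph iq_class S : x y / x - y}.
Proof.
by move=> x y; apply: (addIr (iq_class S y)); rewrite -iq_classD !subrK.
Qed.

Lemma iq_classM x y : iq_class S (x * y) = iq_class S x * iq_class S y.
Proof. exact/esym/iq_mulE. Qed.

Lemma iq_class_gen x : S x -> iq_class S x = 0.
Proof.
move=> Sx; rewrite -iq_class0; apply/iq_classP; rewrite subr0.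
exact: sub_gen_smallest.
Qed.
End IqClass.

(** * From an additive group action to a module over a quotient of the group ring *)

Section GroupAction.
Variables (G : groupType) (M : zmodType) (act : M -> G -> M).
Hypothesis act1 : forall m, act m 1%g = m.
Hypothesis actM : forall m g h, act m (g * h)%g = act (act m g) h.
Hypothesis actB : forall g m n, act (m - n) g = act m g - act n g.

Definition gract (m : M) (a : group_ring G) : M :=
  \sum_(g <- msupp a) act m g *~ a@_g.

(** Allows elements with different supports to be compared over a common finite set. *)
Lemma gractw d m (a : group_ring G) : fsubset (msupp a) d ->
  gract m a = \sum_(g <- d) act m g *~ a@_g.
Proof.
move=> ad; rewrite /gract; apply: big_fset_incl => // g _ /mcoeff_outdom ->.
exact: mulr0z.
Qed.

Lemma gract_gr m g : gract m (gr g) = act m g.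
Proof. by rewrite (gractw _ msuppU_le) big_seq_fset1 mcoeffUU. Qed.

Lemma gractBr m (a b : group_ring G) : gract m (a - b) = gract m a - gract m b.
Proof.
pose d := fsetU (msupp a) (msupp b).
have da : fsubset (msupp a) d by apply: fsubsetUl.
have db : fsubset (msupp b) d by apply: fsubsetUr.
have dab : fsubset (msupp (a - b)) d by apply: msuppB_le.
rewrite (gractw _ da) (gractw _ db) (gractw _ dab) -sumrB /=.
by apply/eq_bigr => g _; rewrite mcoeffB mulrzBr.
Qed.

Lemma gractDr m (a b : group_ring G) : gract m (a + b) = gract m a + gract m b.
Proof. by apply: (addIr (- gract m b)); rewrite addrK -gractBr addrK. Qed.

Lemma gractBl m n (a : group_ring G) : gract (m - n) a = gract m a - gract n a.
Proof.
by rewrite /gract -sumrB; apply/eq_bigr => g _; rewrite actB mulrzBl.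
Qed.

Lemma gract_gr2 m g h : gract m (gr g + gr h) = act m g + act m h.
Proof. by rewrite gractDr; congr (_ + _); exact: gract_gr. Qed.

Lemma gract1 m : gract m 1 = m.
Proof. by rewrite gract_gr. Qed.

Lemma gractM (a b : group_ring G) m : gract m (a * b) = gract (gract m a) b.
Proof.
move: a b m; apply: gr_span => [g|a a' IH IH' b m].
  apply: gr_span => [h|b b' IH IH'] m; first by rewrite -grM !gract_gr actM.
  by rewrite mulrBr !gractBr IH IH'.
by rewrite mulrBl !gractBr gractBl IH IH'.
Qed.

Variable S : set (group_ring G).
Hypothesis actS : forall m a, S a -> gract m a = 0.

Lemma gract_ideal m (a b : group_ring G) : iq_class S a = iq_class S b ->
  gract m a = gract m b.
Proof.
move=> /iq_classP ab; apply/eqP; rewrite -subr_eq0 -gractBr; apply/eqP.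
(* The annihilator of all of [M] is a two-sided ideal containing [S], hence contains the ideal
   generated by [S]. Quantifying over [m] absorbs left factors, as $m(rx) = (mr)x$. *)
apply: (ab (fun a => forall m, gract m a = 0)); split; last first.
  by move=> c Sc {}m; exact: actS.
split=> [{}m|x y Ix Iy {}m|r x Ix {}m|r x Ix {}m].
- by rewrite -(subrr 1) gractBr subrr.
- by rewrite gractBr Ix Iy subrr.
- by rewrite gractM Ix.
- by rewrite gractM Ix -(subrr m) gractBl !subrr.
Qed.

Definition iqact (r : (ideal_quot S)^c) (m : M) : M := gract m (iq_repr r).

Lemma iqactE a m : iqact (iq_class S a) m = gract m a.
Proof. by apply: gract_ideal; rewrite iq_reprK. Qed.

Lemma iqactA r t m : iqact r (iqact t m) = iqact (r * t) m.
Proof.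
(* In the converse ring [r * t] is the class of the product $tr$, so [t] acts first. *)
rewrite [r * t](_ : _ = iq_class S (iq_repr t * iq_repr r)) //.
by rewrite iqactE gractM.
Qed.

Lemma iqact1 m : iqact 1 m = m.
Proof. by rewrite iqactE gract1. Qed.

Lemma iqactDr r m n : iqact r (m + n) = iqact r m + iqact r n.
Proof.
apply: (addIr (- iqact r n)); rewrite addrK -gractBl addrK //.
Qed.

Lemma iqactDl m r t : iqact (r + t) m = iqact r m + iqact t m.
Proof.
rewrite -(iq_reprK r) -(iq_reprK t).
by rewrite -iq_classD !iqactE gractDr.
Qed.

Lemma iqact_gr g m : iqact (iq_class S (gr g)) m = act m g.
Proof. by rewrite iqactE gract_gr. Qed.
End GroupAction.

Section Linear.
Variables (G : groupType) (S : set (group_ring G)).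
Local Notation R := (ideal_quot S)^c.

Definition mact (M : lmodType R) (m : M) (g : G) : M :=
  (iq_class S (gr g) : R) *: m.

Lemma mact1 (M : lmodType R) (m : M) : mact m 1%g = m.
Proof. exact: scale1r. Qed.

Lemma mactM (M : lmodType R) (m : M) g h :
  mact m (g * h)%g = mact (mact m g) h.
Proof. by rewrite /mact grM iq_classM scalerA. Qed.

Lemma mactD (M : lmodType R) g : {morph @mact M ^~ g : m n / m + n}.
Proof. by move=> m n; exact: scalerDr. Qed.

Lemma mact0 (M : lmodType R) g : @mact M 0 g = 0.
Proof. exact: scaler0. Qed.

Lemma mactN (M : lmodType R) g : {morph @mact M ^~ g : m / - m}.
Proof. by move=> m; exact: scalerN. Qed.

Lemma mact_eq0 (M : lmodType R) (m : M) g h :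
  S (gr g + gr h) -> mact m g + mact m h = 0.
Proof.
by move=> gh; rewrite /mact -scalerDl -iq_classD iq_class_gen // scale0r.
Qed.

(** The classes of group elements generate the quotient ring additively. *)
Lemma gr_scalable (M N : lmodType R) (f : M -> N) :
  zmod_morphism f -> (forall m g, f (mact m g) = mact (f m) g) -> scalable f.
Proof.
move=> fB fg r; rewrite -(iq_reprK r); elim/gr_span: (iq_repr r)
  => [g m|a b IHa IHb m].
  exact: fg.
by rewrite iq_classB !scalerBl fB IHa IHb.
Qed.

Definition gr_linear (M N : lmodType R) (f : M -> N) (fB : zmod_morphism f)
    (fg : forall m g, f (mact m g) = mact (f m) g) : {linear M -> N} :=
  HB.pack f (GRing.isZmodMorphism.Build M N f fB)
    (GRing.isScalable.Build R M N *:%R f (gr_scalable fB fg)).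
End Linear.

(** * The module structure on the fibre over e *)

Section FibreModule.
Variables (Q : ssqType) (e : Q) (A : abgrp_obj (slice_cartesian Q)).

Definition fibre : Type := {a : tot A | proj a = e}.
HB.instance Definition _ := gen_eqMixin fibre.
HB.instance Definition _ := gen_choiceMixin fibre.

Implicit Types a b c : fibre.

Lemma fibre_ext a b : sval a = sval b -> a = b.
Proof. by case: a b => a ha [b hb] /= ab; apply: eq_exist. Qed.

Lemma fibre_proj a b : proj (sval a) = proj (sval b).
Proof. by rewrite (svalP a) (svalP b). Qed.

Lemma fadd_fibre a b : proj (fadd (sval a) (sval b)) = e.
Proof. by rewrite proj_fadd (svalP a). Qed.

Lemma neg_fibre a : proj (neg (sval a)) = e.
Proof. by rewrite proj_neg (svalP a). Qed.

Definition fib_add a b : fibre := exist _ _ (fadd_fibre a b).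
Definition fib_opp a : fibre := exist _ _ (neg_fibre a).
Definition fib_zero : fibre := exist _ _ (proj_zeros A e).

Lemma fib_addA : associative fib_add.
Proof.
move=> a b c; apply: fibre_ext => /=; apply: faddA; exact: fibre_proj.
Qed.
Lemma fib_addC : commutative fib_add.
Proof. by move=> a b; apply/fibre_ext/faddC/fibre_proj. Qed.
Lemma fib_add0 : left_id fib_zero fib_add.
Proof.
by move=> a; apply: fibre_ext; rewrite /= -[in zeros A _](svalP a) fadd0.
Qed.
Lemma fib_addN : left_inverse fib_zero fib_opp fib_add.
Proof. by move=> a; apply: fibre_ext; rewrite /= faddN (svalP a). Qed.

HB.instance Definition _ := GRing.isZmodule.Build fibre
  fib_addA fib_addC fib_add0 fib_addN.

Lemma fib_addE a b : sval (a + b) = fadd (sval a) (sval b).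
Proof. by []. Qed.

Lemma fib_zeroE : sval (0 : fibre) = zeros A e.
Proof. by []. Qed.

Lemma uact_fibre a (g : ustab e) : proj (uact (zeros A) g (sval a)) = e.
Proof. by rewrite proj_uact (svalP a) pt_stab. Qed.

Definition fib_act a (g : ustab e) : fibre := exist _ _ (uact_fibre a g).

Lemma fib_actE a g : sval (fib_act a g) = uact (zeros A) g (sval a).
Proof. by []. Qed.

Lemma fib_act1 a : fib_act a 1%g = a.
Proof. by apply: fibre_ext; exact: uact1. Qed.

Lemma fib_actM a g h : fib_act a (g * h)%g = fib_act (fib_act a g) h.
Proof. by apply: fibre_ext; exact: uactM. Qed.

Lemma fib_actD g a b : fib_act (a + b) g = fib_act a g + fib_act b g.
Proof. by apply/fibre_ext/uact_fadd/fibre_proj. Qed.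

Lemma fib_actB g a b : fib_act (a - b) g = fib_act a g - fib_act b g.
Proof. by apply: (addIr (fib_act b g)); rewrite -fib_actD !subrK. Qed.
End FibreModule.

(** * Transport of the action to the stabilizer of $e$ *)

Section Transport.
Variables (Q : ssqType) (e : Q).

Lemma pt_RtVe x : pt (Rt (x ** e))^-1%g x = e.
Proof. by rewrite pt_RtV semisym. Qed.

Lemma pt_Rte x : pt (Rt (x ** e)) e = x.
Proof. by rewrite pt_Rt semisymr. Qed.

(* The loop e -> x -> xg -> e obtained from g by going along R(xe) and back
   along R((xg)e)^-1. *)
Definition tr_val (x : Q) (g : umult Q) : umult Q :=
  (Rt (x ** e) * g * (Rt (pt g x ** e))^-1)%g.

Lemma tr_subproof x g :
  tr_val x g (polyq_inj Q e) == polyq_inj Q e.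
Proof. by apply/eqP/pt_fix; rewrite !ptM pt_Rte pt_RtVe. Qed.

Definition tr x g : ustab e := UStab (tr_subproof x g).

Lemma ustab_val_inj : injective (@ustab_val Q e).
Proof. exact: val_inj. Qed.

Lemma trE x g : ustab_val (tr x g) = tr_val x g.
Proof. by []. Qed.

Lemma tr1 x : tr x 1%g = 1%g.
Proof. by apply: ustab_val_inj; rewrite /= /tr_val pt1 mulg1 mulgV. Qed.

(** The inner factors $R(ye)^{-1}$ and $R(ye)$ cancel. So [tr] is a functor from the action groupoid
    of $Q$ to the stabilizer. *)
Lemma trM x y g h : pt g x = y -> (tr x g * tr y h)%g = tr x (g * h)%g.
Proof.
move=> gx; apply: ustab_val_inj => /=.
rewrite [LHS](_ : _ = tr_val x g * tr_val y h)%g // /tr_val ptM gx.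
by rewrite !mulgA mulgVK.
Qed.

Lemma tr_RR x y : ustab_val (tr y (Rt x * Rt y)%g) =
  (Rt (y ** e) * (Rt x * Rt y) * (Rt (x ** e))^-1)%g.
Proof. by rewrite trE /tr_val ptM !pt_Rt semisym. Qed.

Lemma tr_RV x y : ustab_val (tr y (Rt (y ** x))^-1%g) =
  (Rt (y ** e) * (Rt (y ** x))^-1 * (Rt (x ** e))^-1)%g.
Proof. by rewrite trE /tr_val pt_RtV semisym. Qed.

(** Both $R(x)R(y)$ and $R(yx)^{-1}$ lead from $y$ to $(yx)y = x$, so the outer factors of the
    relator close each of them to a loop at $e$. *)
Lemma tr_relator x y : gr_map (@ustab_val Q e)
    (gr (tr y (Rt x * Rt y)%g) + gr (tr y (Rt (y ** x))^-1%g)) = relator e x y.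
Proof. by rewrite gr_map_gr2 tr_RR tr_RV -gr_conj. Qed.

(** Injectivity of [gr_map] lets [tr_relator] be read inside the group ring of the stabilizer. *)
Lemma relatorsP (a : group_ring (ustab e)) : relators e a <->
  exists x y : Q, a = gr (tr y (Rt x * Rt y)%g) + gr (tr y (Rt (y ** x))^-1%g).
Proof.
split=> [[x [y axy]]|[x [y ->]]]; exists x, y; last exact: tr_relator.
by apply: (gr_map_inj ustab_val_inj); rewrite axy tr_relator.
Qed.

Lemma Ree_subproof : Rt (e ** e) (polyq_inj Q e) == polyq_inj Q e.
Proof. by apply/eqP/pt_fix; rewrite pt_Rte. Qed.

Definition Ree : ustab e := UStab Ree_subproof.

(** The path chosen from $e$ to itself is $R(ee)$, so transporting a loop at $e$ conjugates it by
    $R(ee)$; the counit undoes this twist. *)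
Lemma tr_Ree (g : ustab e) : (tr e g * Ree)%g = (Ree * g)%g.
Proof.
apply: ustab_val_inj; rewrite [LHS](_ : _ = tr_val e g * Rt (e ** e))%g //.
by rewrite /tr_val pt_stab mulgVK.
Qed.

End Transport.

Section FibreLmodule.
Variables (Q : ssqType) (e : Q) (A : abgrp_obj (slice_cartesian Q)).
Local Notation R := (ideal_quot (relators e))^c.

Lemma fib_relators (m : fibre e A) (a : group_ring (ustab e)) :
  relators e a -> gract (@fib_act Q e A) m a = 0.
Proof.
move=> /relatorsP[x [y ->]].
rewrite gract_gr2; apply: fibre_ext.
rewrite fib_zeroE fib_addE !fib_actE tr_RR tr_RV.
(* Moved along $R(ye)$, [m] lies over $y$, where [fadd_relator] gives the sum $0_x$; the common
   factor $R(xe)^{-1}$ carries $0_x$ to $0_e$. *)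
set m' := uact (zeros A) (Rt (y ** e)) (sval m).
have m'y : proj m' = y by rewrite proj_uact (svalP m) pt_Rte.
have actE g : uact (zeros A) (Rt (y ** e) * g * (Rt (x ** e))^-1)%g (sval m) =
    uact (zeros A) (Rt (x ** e))^-1%g (uact (zeros A) g m') by rewrite !uactM.
clearbody m'; rewrite !actE -uact_fadd; last first.
  by rewrite !proj_uact m'y ptM !pt_Rt pt_RtV.
by rewrite fadd_relator // uact_zeros pt_RtVe.
Qed.

HB.instance Definition _ := GRing.Zmodule_isLmodule.Build R (fibre e A)
  (iqactA (@fib_actM Q e A) (@fib_actB Q e A) fib_relators)
  (iqact1 (@fib_act1 Q e A) (@fib_actM Q e A) (@fib_actB Q e A) fib_relators)
  (iqactDr (S := relators e) (@fib_actB Q e A))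
  (iqactDl (@fib_actM Q e A) (@fib_actB Q e A) fib_relators).

Lemma mact_fibre (m : fibre e A) (g : ustab e) : mact m g = fib_act m g.
Proof.
exact: (iqact_gr (@fib_actM Q e A) (@fib_actB Q e A) fib_relators).
Qed.

End FibreLmodule.

(** * The abelian group object of a module *)

Section SemidirectProduct.
Variables (Q : ssqType) (e : Q) (M : lmodType (ideal_quot (relators e))^c).

Definition sdp : Type := (Q * M)%type.
Implicit Types u v : sdp.

(** The formula of [tot_mulE] with every fibre identified with [M]: the arrows $R(y)$ from $x$ and
    $R(x)^{-1}$ from $y$, both ending at $xy$, act through their loops at $e$. *)
Definition sd_mul u v : sdp :=
  (u.1 ** v.1,
   mact u.2 (tr e u.1 (Rt v.1)) + mact v.2 (tr e v.1 (Rt u.1)^-1%g)).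

(** By [trM], the two contributions of [v.2] come from the two terms of a relator and cancel, while
    [u.2] is moved along $R(y)^{-1}R(y) = 1$. *)
Lemma sd_semisym u v : sd_mul (sd_mul v u) v = u.
Proof.
case: u v => [x m] [y n]; rewrite /sd_mul /= semisym; congr (_, _).
rewrite mactD -!mactM !trM ?pt_Rt ?pt_RtV // mulVg tr1 mact1 addrAC.
rewrite mact_eq0 ?add0r //; by apply/relatorsP; exists x, y.
Qed.

Lemma sd_semisymr u v : sd_mul v (sd_mul u v) = u.
Proof. by rewrite -{1}(sd_semisym v u) sd_semisym. Qed.

HB.instance Definition _ := isQuasigroup.Build sdp
  (qrdiv := fun u v => sd_mul v u) (qldiv := fun v u => sd_mul u v)
  (fun u v => sd_semisym u v) (fun u v => esym (sd_semisymr u v))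
  (fun u v => sd_semisymr u v) (fun u v => esym (sd_semisym u v)).
HB.instance Definition _ := isSemisymmetric.Build sdp sd_semisym.

End SemidirectProduct.

(** * Morphisms of abelian group objects *)

Section Homs.
Variables (Q : ssqType) (A B : abgrp_obj (slice_cartesian Q)).

Definition ah_slice (f : abgrp_hom A B) : slice_hom (ag_obj A) (ag_obj B) :=
  ah_hom f.

Definition ah_fun (f : abgrp_hom A B) : ssq_hom (tot A) (tot B) :=
  sl_hom (ah_slice f).

Lemma abgrp_hom_eq (f g : abgrp_hom A B) : ah_fun f =1 ah_fun g -> f = g.
Proof. by move=> fg; apply/abgrp_hom_ext/slice_hom_ext/ssq_hom_ext. Qed.

Section HomFacts.
Variable f : abgrp_hom A B.

Lemma proj_ah a : proj (ah_fun f a) = proj a.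
Proof. exact: (congr1 (fun h : ssq_hom _ _ => h a) (sl_homP (ah_slice f))). Qed.

Lemma ah_zeros x : ah_fun f (zeros A x) = zeros B x.
Proof. exact: (sl_eval_eq (ah_zero f) x). Qed.

Lemma ah_fadd a b : proj a = proj b ->
  ah_fun f (fadd a b) = fadd (ah_fun f a) (ah_fun f b).
Proof.
move=> ab; have fab : proj (ah_fun f a) = proj (ah_fun f b) by rewrite !proj_ah.
rewrite (faddE ab) (faddE fab).
apply: etrans (sl_eval_eq (ah_add f) (exist _ (a, b) ab)) _.
by apply: (congr1 (@addp Q B)); apply: pullback_ext.
Qed.

Lemma ah_uact g a :
  ah_fun f (uact (zeros A) g a) = uact (zeros B) g (ah_fun f a).
Proof. by apply: uact_nat => q; rewrite ah_zeros. Qed.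
End HomFacts.

Section Builder.
Variable f : tot A -> tot B.
Hypothesis fM : {morph f : a b / a ** b}.
Hypothesis f_proj : forall a, proj (f a) = proj a.
Hypothesis fD : forall a b, proj a = proj b -> f (fadd a b) = fadd (f a) (f b).

Lemma build_slP : ssq_comp proj (hom_of_mul fM) = proj.
Proof. exact/ssq_hom_ext/f_proj. Qed.

Definition build_slice : slice_hom (ag_obj A) (ag_obj B) :=
  @SliceHom ssq_cat Q (ag_obj A) (ag_obj B) (hom_of_mul fM) build_slP.

Lemma build_zeros x : f (zeros A x) = zeros B x.
Proof.
rewrite -[x in RHS](proj_zeros A) -f_proj; apply: fadd_idem.
by rewrite -fD // -[in RHS](fadd0 (zeros A x)) proj_zeros.
Qed.

Lemma build_neg a : f (neg a) = neg (f a).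
Proof.
apply: fadd_eq0; rewrite ?f_proj ?proj_neg //.
rewrite faddC; last by rewrite !f_proj proj_neg.
by rewrite -fD ?proj_neg // faddN build_zeros.
Qed.

(** The remaining compatibilities follow: [hom_of_mul] handles divisions, a zero goes to an
    idempotent of a group, and negatives in a fibre are unique. *)
Program Definition build_hom : abgrp_hom A B :=
  @AbgrpHom _ (slice_cartesian Q) A B build_slice _ _ _.
Next Obligation.
apply/slice_hom_ext/ssq_hom_ext => -[[a b] ab].
have fab : proj (f a) = proj (f b).
  exact: etrans (f_proj a) (etrans ab (esym (f_proj b))).
apply: etrans (congr1 f (esym (faddE ab))) _.
apply: etrans (fD ab) _; apply: etrans (faddE fab) _.
by apply: (congr1 (@addp Q B)); apply: pullback_ext.
Qed.
Next Obligation. exact/slice_hom_ext/ssq_hom_ext/build_zeros. Qed.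
Next Obligation. exact/slice_hom_ext/ssq_hom_ext/build_neg. Qed.
End Builder.
End Homs.

Section Inverse.
Variables (Q : ssqType) (A B : abgrp_obj (slice_cartesian Q)).
Variables (f : tot A -> tot B) (k : tot B -> tot A).
Hypothesis fM : {morph f : a b / a ** b}.
Hypothesis f_proj : forall a, proj (f a) = proj a.
Hypothesis fD : forall a b, proj a = proj b -> f (fadd a b) = fadd (f a) (f b).
Hypotheses (fK : cancel f k) (kK : cancel k f).

Lemma inv_morph : {morph k : a b / a ** b}.
Proof. by move=> a b; apply: (can_inj fK); rewrite fM !kK. Qed.

Lemma inv_proj a : proj (k a) = proj a.
Proof. by rewrite -f_proj kK. Qed.

Lemma inv_fadd a b : proj a = proj b -> k (fadd a b) = fadd (k a) (k b).
Proof.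
by move=> ab; apply: (can_inj fK); rewrite fD ?inv_proj // !kK.
Qed.
End Inverse.

(** * The functor taking the fibre over $e$ *)

Section FibreFunctor.
Variables (Q : ssqType) (e : Q).
Local Notation AQ := (abgrp_cat (slice_cartesian Q)).
Local Notation R := (ideal_quot (relators e)).

Section Map.
Variables (A B : abgrp_obj (slice_cartesian Q)) (f : abgrp_hom A B).

Lemma fibre_mapP (a : fibre e A) : proj (ah_fun f (sval a)) = e.
Proof. by rewrite proj_ah (svalP a). Qed.

Definition fibre_map (a : fibre e A) : fibre e B := exist _ _ (fibre_mapP a).

Lemma fibre_mapB : zmod_morphism fibre_map.
Proof.
move=> a b; apply: (addIr (fibre_map b)); rewrite subrK.
apply: fibre_ext; rewrite fib_addE -ah_fadd; last exact: fibre_proj.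
by rewrite -fib_addE subrK.
Qed.

Lemma fibre_map_mact m g : fibre_map (mact m g) = mact (fibre_map m) g.
Proof. by rewrite !mact_fibre; apply: fibre_ext; exact: ah_uact. Qed.

Definition fibre_lin : {linear fibre e A -> fibre e B} :=
  gr_linear fibre_mapB fibre_map_mact.
End Map.

Program Definition fibre_functor : functor AQ (rmod_cat R) :=
  @Functor AQ (rmod_cat R) (fun A => fibre e A : lmodType R^c)
    (fun A B f => fibre_lin f) _ _.
Next Obligation. by move=> A; apply: linear_ext => a; exact: fibre_ext. Qed.
Next Obligation.
by move=> A B C g f; apply: linear_ext => a; exact: fibre_ext.
Qed.
End FibreFunctor.

(** * The abelian group structure on $Q \times M$ *)

Section SdpObject.
Variables (Q : ssqType) (e : Q) (M : lmodType (ideal_quot (relators e))^c).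
Local Notation E := (sdp M).

Definition sd_proj : ssq_hom E Q :=
  @hom_of_mul E Q (fun u => u.1) (fun _ _ => erefl).

Lemma sd_zeroM x y : ((x ** y, 0) : E) = ((x, 0) : E) ** ((y, 0) : E).
Proof. by congr (_, _); rewrite /= !mact0 addr0. Qed.

Definition sd_zero : ssq_hom Q E := @hom_of_mul Q E (fun x => (x, 0)) sd_zeroM.

Lemma sd_oppM (u v : E) :
  (((u ** v).1, - (u ** v).2) : E) = ((u.1, - u.2) : E) ** ((v.1, - v.2) : E).
Proof. by congr (_, _); rewrite /= !mactN opprD. Qed.

Definition sd_opp : ssq_hom E E :=
  @hom_of_mul E E (fun u => (u.1, - u.2)) sd_oppM.

Definition sd_plus (p : pullback sd_proj sd_proj) : E :=
  ((sval p).1.1, (sval p).1.2 + (sval p).2.2).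

Lemma sd_plusM p q : sd_plus (p ** q) = sd_plus p ** sd_plus q.
Proof.
case: p q => -[[x m] [x' m']] /= xx' [[[y n] [y' n']] /= yy'].
case: x' / xx'; case: y' / yy'.
by congr (_, _); rewrite /= !mactD addrACA.
Qed.

Definition sd_add : ssq_hom (pullback sd_proj sd_proj) E := hom_of_mul sd_plusM.

Definition sd_slice : slice_obj (Q : ssq_cat) :=
  @SliceObj ssq_cat Q (E : ssqType) sd_proj.

Local Notation P := (slice_cartesian Q).
Local Notation SQ := (@slice ssq_cat Q).

Program Definition sd_abgrp : abgrp_obj P :=
  @AbgrpObj SQ P sd_slice
    (@SliceHom ssq_cat Q (cprod P sd_slice sd_slice) sd_slice sd_add _)
    (@SliceHom ssq_cat Q (cone P) sd_slice sd_zero _)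
    (@SliceHom ssq_cat Q sd_slice sd_slice sd_opp _) _ _ _ _.
Next Obligation. exact: ssq_hom_ext. Qed.
Next Obligation. exact: ssq_hom_ext. Qed.
Next Obligation. exact: ssq_hom_ext. Qed.
Next Obligation.
apply/slice_hom_ext/ssq_hom_ext => p; congr (_, _); exact: addrA.
Qed.
Next Obligation.
apply/slice_hom_ext/ssq_hom_ext => -[[u v] uv]; congr (_, _).
  exact: esym uv.
exact: addrC.
Qed.
Next Obligation.
apply/slice_hom_ext/ssq_hom_ext => -[x m]; congr (_, _); exact: add0r.
Qed.
Next Obligation.
apply/slice_hom_ext/ssq_hom_ext => -[x m]; congr (_, _); exact: addNr.
Qed.
End SdpObject.

(** * The equivalence *)

Section SdpFunctor.
Variables (Q : ssqType) (e : Q).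
Local Notation AQ := (abgrp_cat (slice_cartesian Q)).
Local Notation R := (ideal_quot (relators e)).

Lemma fadd_sd (M : lmodType R^c) (u v : tot (sd_abgrp M)) : proj u = proj v ->
  fadd u v = (u.1, u.2 + v.2).
Proof. by move=> uv; rewrite (faddE uv). Qed.

(** For $R(q)$ the action multiplies by $(q, 0)$, which leaves only the transported summand; [trM]
    extends this to products and inverses. *)
Lemma uact_sd (M : lmodType R^c) g (u : tot (sd_abgrp M)) :
  uact (zeros (sd_abgrp M)) g u = (pt g u.1, mact u.2 (tr e u.1 g)).
Proof.
elim/umult_ind: g u => [q|||] => [u|u|g h IHg IHh u|g IHg u].
- by rewrite uact_Rt pt_Rt; congr (_, _); rewrite /= mact0 addr0.
- by rewrite uact1 pt1 tr1 mact1 -surjective_pairing.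
- by rewrite uactM IHg IHh /= -mactM (trM e _ erefl) ptM.
apply: (can_inj (uactK (zeros (sd_abgrp M)) g)).
rewrite uactVK IHg /= -ptM mulVg pt1 -mactM (trM e _ erefl) mulVg tr1 mact1.
exact: surjective_pairing.
Qed.

Section Map.
Variables (M N : lmodType R^c) (f : {linear M -> N}).

Definition sd_fun (u : tot (sd_abgrp M)) : tot (sd_abgrp N) := (u.1, f u.2).

Lemma sd_funM : {morph sd_fun : u v / u ** v}.
Proof. by move=> u v; congr (_, _); rewrite /= linearD /mact !linearZ. Qed.

Lemma sd_fun_fadd u v : proj u = proj v ->
  sd_fun (fadd u v) = fadd (sd_fun u) (sd_fun v).
Proof. by move=> uv; rewrite !fadd_sd //; congr (_, _); rewrite /= linearD. Qed.

Definition sd_hom : abgrp_hom (sd_abgrp M) (sd_abgrp N) :=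
  build_hom sd_funM (fun=> erefl) sd_fun_fadd.
End Map.

Program Definition sd_functor : functor (rmod_cat R) AQ :=
  @Functor (rmod_cat R) AQ (fun M : lmodType R^c => sd_abgrp M)
    (fun M N f => sd_hom f) _ _.
Next Obligation. by move=> M; apply: abgrp_hom_eq => -[]. Qed.
Next Obligation. by move=> M N P g f; apply: abgrp_hom_eq => -[]. Qed.

Section Counit.
Variable M : lmodType R^c.
Local Notation F := (fibre e (sd_abgrp M)).

(** Over $e$, an element $g$ of the stabilizer acts on [M] through [tr e g]; by [tr_Ree] the factor
    $R(ee)$ turns this into the original action of $g$. *)
Definition counit_fun (a : F) : M := mact (sval a).2 (Ree e).

Lemma counit_funB : zmod_morphism counit_fun.
Proof.
move=> a b; apply: (addIr (counit_fun b)); rewrite subrK -mactD; congr mact.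
have -> : sval a = fadd (sval (a - b)) (sval b) by rewrite -fib_addE subrK.
rewrite fadd_sd //; exact: fibre_proj.
Qed.

Lemma counit_fun_mact a g : counit_fun (mact a g) = mact (counit_fun a) g.
Proof.
rewrite mact_fibre /counit_fun fib_actE uact_sd /= (svalP a : (sval a).1 = e).
by rewrite -[LHS]mactM tr_Ree; exact: mactM.
Qed.

Definition counit_inv (m : M) : F :=
  exist (fun u => proj u = e)
    ((e, mact m (Ree e)^-1%g) : tot (sd_abgrp M)) erefl.

Lemma counit_funK : cancel counit_fun counit_inv.
Proof.
case=> -[x m] /= xe; apply: fibre_ext; congr (_, _) => //=.
by rewrite /counit_fun -mactM mulgV mact1.
Qed.

Lemma counit_invK : cancel counit_inv counit_fun.
Proof. by move=> m; rewrite /counit_fun -mactM mulVg mact1. Qed.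

Lemma counit_invB : zmod_morphism counit_inv.
Proof.
by move=> m n; apply: (can_inj counit_funK); rewrite counit_funB !counit_invK.
Qed.

Lemma counit_inv_mact m g : counit_inv (mact m g) = mact (counit_inv m) g.
Proof.
by apply: (can_inj counit_funK); rewrite counit_fun_mact !counit_invK.
Qed.
End Counit.

Section Unit.
Variable A : abgrp_obj (slice_cartesian Q).
Local Notation E := (tot (sd_abgrp (fibre e A))).
Local Notation "a ^^ g" := (uact (zeros A) g a) (at level 30).

(** Moves an element over $e$ to the fibre over $x$ along $R(xe)$, the same path as in [tr_val]. *)
Definition unit_fun (u : E) : tot A := sval u.2 ^^ Rt (u.1 ** e).

(** The last factor of [tr_val] cancels, so moving from the fibre over $e$ intertwines the
    transported loops with the actual action. *)
Lemma uact_tr x (g : umult Q) (a : tot A) :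
  (a ^^ tr e x g) ^^ Rt (pt g x ** e) = (a ^^ Rt (x ** e)) ^^ g.
Proof. by rewrite trE -!uactM /tr_val mulgVK. Qed.

Lemma proj_unit_fun u : proj (unit_fun u) = proj u.
Proof. by rewrite proj_uact (svalP u.2) pt_Rte. Qed.

Lemma unit_fun_fadd u v : proj u = proj v ->
  unit_fun (fadd u v) = fadd (unit_fun u) (unit_fun v).
Proof.
move=> uv; rewrite fadd_sd // /unit_fun fib_addE uact_fadd.
  by rewrite [v.1](esym uv : _ = u.1).
exact: fibre_proj.
Qed.

(** The summands of [sd_mul] and of [tot_mulE] are matched one by one by [uact_tr]. *)
Lemma unit_funM : {morph unit_fun : u v / u ** v}.
Proof.
move=> u v; rewrite [RHS]tot_mulE !proj_unit_fun.
have uvE : sval (u ** v).2 = fadd (sval u.2 ^^ tr e u.1 (Rt v.1))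
    (sval v.2 ^^ tr e v.1 (Rt u.1)^-1%g).
  by rewrite -!fib_actE -fib_addE -!mact_fibre.
rewrite [LHS]/unit_fun uvE uact_fadd; last first.
  by rewrite -!fib_actE; exact: fibre_proj.
by rewrite /unit_fun -!uact_tr pt_Rt pt_RtV.
Qed.

Lemma unit_inv_subproof (a : tot A) : proj (a ^^ (Rt (proj a ** e))^-1%g) = e.
Proof. by rewrite proj_uact pt_RtVe. Qed.

Definition unit_inv (a : tot A) : E :=
  (proj a, exist (fun u => proj u = e) _ (unit_inv_subproof a)).

Lemma unit_funK : cancel unit_fun unit_inv.
Proof.
move=> u; rewrite [RHS]surjective_pairing; congr (_, _).
  exact: proj_unit_fun.
apply: fibre_ext; transitivity
  (unit_fun u ^^ (Rt (proj (unit_fun u) ** e))^-1%g) => //.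
by rewrite (proj_unit_fun u : _ = u.1) uactK.
Qed.

Lemma unit_invK : cancel unit_inv unit_fun.
Proof. by move=> a; rewrite /unit_fun /= uactVK. Qed.
End Unit.

Program Definition unit_iso :
    nat_iso (fcomp sd_functor (fibre_functor e)) (fid AQ) :=
  @NatIso AQ AQ _ _
    (fun A => build_hom (@unit_funM A) (@proj_unit_fun A) (@unit_fun_fadd A))
    (fun A => build_hom (inv_morph (@unit_funM A) (@unit_funK A) (@unit_invK A))
      (inv_proj (@proj_unit_fun A) (@unit_invK A))
      (inv_fadd (@proj_unit_fun A) (@unit_fun_fadd A) (@unit_funK A)
        (@unit_invK A))) _ _ _.
Next Obligation. by move=> A; apply: abgrp_hom_eq => u; exact: unit_funK. Qed.
Next Obligation. by move=> A; apply: abgrp_hom_eq => u; exact: unit_invK. Qed.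
Next Obligation.
(* Morphisms commute with the action, here that of $R(xe)$. *)
move=> A B f; apply: abgrp_hom_eq => u; exact/esym/ah_uact.
Qed.

Program Definition counit_iso :
    nat_iso (fcomp (fibre_functor e) sd_functor) (fid (rmod_cat R)) :=
  @NatIso (rmod_cat R) (rmod_cat R) _ _
    (fun M => gr_linear (@counit_funB M) (@counit_fun_mact M))
    (fun M => gr_linear (@counit_invB M) (@counit_inv_mact M)) _ _ _.
Next Obligation. by move=> M; apply: linear_ext => a; exact: counit_funK. Qed.
Next Obligation. by move=> M; apply: linear_ext => a; exact: counit_invK. Qed.
Next Obligation.
by move=> M N f; apply: linear_ext => a; rewrite /= /counit_fun /mact linearZ.
Qed.
End SdpFunctor.

Theorem theorem4p5 (Q : ssqType) (e : Q) :
  equivalent (abgrp_cat (slice_cartesian Q))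
    (rmod_cat (ideal_quot (relators e))).
Proof.
exists (fibre_functor e), (sd_functor e).
by split; constructor; [exact: unit_iso|exact: counit_iso].
Qed.
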